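(* Let $d>0$, and for $n\ge3$ let $\mathbf{b}=(d,\ldots,d)\in\mathbb{R}^n$ and $$\beta_n(d)=\min\{B_T(\sigma(\mathbf{b}))\,|\,T\in\mathcal{T}_n,\ \sigma\in S_n\}.$$ For any $n>4$, $\beta_n(d)>(n-2)A_m(d)$, where $A_m(d)$ is the area of a semicyclic hyperbolic triangle with two (shorter) sides of length $d$. For $n=4$, $\beta_4(d)=2A_m(d)$, and for $n=3$, $\beta_3(d)$ equals the area of an equilateral hyperbolic triangle with all side lengths $d$. (That is, $\beta_n(d)$ is larger than the lower bound on areas of centered dual two-cells with $n$ edges of length at least $d$ given by an earlier theorem of the author for $n>4$, and equals it for $n=3,4$; the earlier bound is $(n-2)A_m(d)$ for $n\ge4$ and the area of the equilateral triangle of side length $d$ for $n=3$.)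
   Context: **Cyclic polygons.** A cyclic $n$-gon ($n\ge3$) is a convex polygon in $\mathbb{H}^2$ whose $n$ vertices lie on a hyperbolic circle (its circumcircle); its circumcircle center need not lie in the polygon. It is determined up to isometry by its cyclically ordered side lengths. $\mathcal{AC}_n\subset(\mathbb{R}^+)^n$ is the open set of side-length tuples of cyclic $n$-gons; explicitly $(d_0,\ldots,d_{n-1})\in\mathcal{AC}_n$ iff $\sinh(d_i/2)<\sum_{j\ne i}\sinh(d_j/2)$ for every $i$. $\mathcal{BC}_n\subset\mathcal{AC}_n$ consists of the tuples of semicyclic $n$-gons (those whose circumcircle center lies in a side, which is then the longest side and a diameter). $D_0:\mathcal{AC}_n\to\mathbb{R}$ is the area of the corresponding cyclic $n$-gon; it is symmetric in its inputs. $b_0:(\mathbb{R}^+)^{n-1}\to\mathbb{R}^+$ is the function such that $b_0(d_1,\ldots,d_{n-1})$ is the unique number larger than every $d_i$ with $(b_0(d_1,\ldots,d_{n-1}),d_1,\ldots,d_{n-1})\in\mathcal{BC}_n$. In particular $A_m(d)=D_0(d,d,b_0(d,d))$. **Trees.** $T$ is a compact (finite) rooted tree with root vertex $v_T$, edge set $\mathcal{E}$, vertex set $T^{(0)}$ ($T=\{v_T\}$ is allowed), regarded as a subgraph of an ambient graph; its frontier $\mathcal{F}$ is the collection of edges of that graph that intersect $T$ but do not lie in it, and each frontier edge has exactly one vertex in $T$. For $v\in T^{(0)}-\{v_T\}$, $e_v$ is the initial edge of the arc of $T$ joining $v$ to $v_T$. For $\mathbf{d}=(\mathbf{d}_{\mathcal{E}},\mathbf{d}_{\mathcal{F}})$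 and a vertex $v$ of $T$, $P_v(\mathbf{d})$ is the tuple of entries $d_e$ over the edges $e\in\mathcal{E}\cup\mathcal{F}$ containing $v$. $\mathcal{T}_n$ is the collection (up to isomorphism) of compact rooted trees $T$ with frontier $\mathcal{F}$ of order $n$ and each vertex of $T$ trivalent in $T\cup\bigcup_{f\in\mathcal{F}}f$. **The function $B_T$.** Given $T\in\mathcal{T}_n$ and $\mathbf{b}_{\mathcal{F}}\in(\mathbb{R}^+)^{\mathcal{F}}$, define $\mathbf{b}_{\mathcal{E}}=(b_e)_{e\in\mathcal{E}}$ recursively, moving toward the root: for $v\in T^{(0)}-\{v_T\}$, $b_{e_v}=b_0(b_{e_1},b_{e_2})$ where $e_1,e_2$ are the edges of $\mathcal{E}\cup\mathcal{F}$ other than $e_v$ containing $v$. Enumerate the edges containing $v_T$ as $e_0,e_1,e_2$ with $b_{e_0}$ maximal, let $m_{e_0}=\min\{b_{e_0},b_0(b_{e_1},b_{e_2})\}$, and set $$B_T(\mathbf{b}_{\mathcal{F}})=D_0(m_{e_0},b_{e_1},b_{e_2})+\sum_{v\in T^{(0)}-\{v_T\}}D_0(P_v(\mathbf{b}_{\mathcal{E}},\mathbf{b}_{\mathcal{F}})).$$ For each $T\in\mathcal{T}_n$ an enumeration $f_1,\ldots,f_n$ of $\mathcal{F}$ is fixed and $(b_1,\ldots,b_n)$ is regarded as an element of $(\mathbb{R}^+)^{\mathcal{F}}$ by $b_{f_i}=b_i$; $\sigma\in S_n$ acts by permuting entries. *)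

(* Defs.v *)
From HB Require Import structures.
From mathcomp Require Import all_boot all_order all_algebra all_fingroup.
From mathcomp Require Import all_classical all_reals all_analysis.

Set Implicit Arguments.
Unset Strict Implicit.
Unset Printing Implicit Defensive.

Import Order.TTheory GRing.Theory Num.Theory.
Import numFieldNormedType.Exports.

Local Open Scope classical_set_scope.
Local Open Scope ring_scope.

(** * The hyperbolic plane

    The model is the upper half-plane {(x, y) | 0 < y} with the metric
    (dx^2 + dy^2) / y^2; a point is a pair of reals, and positivity of the
    second coordinate is imposed where points are introduced. *)

Section Hyperbolic.
Context {R : realType}.
Implicit Types (p q r c : R * R) (s : seq R).

Definition arcosh (u : R) : R := ln (u + Num.sqrt (u ^+ 2 - 1)).

Definition hdist p q : R :=
  arcosh (1 + ((p.1 - q.1) ^+ 2 + (p.2 - q.2) ^+ 2) / (2 * p.2 * q.2)).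

Definition harea (S : set (R * R)) : R :=
  \int[(@lebesgue_measure R \x @lebesgue_measure R)%E]_(z in S) (z.2 ^- 2).

(* The determinant of the rows (1, x, x^2 + y^2) at p, q, r.  The geodesics are
   the vertical lines and the half-circles centred on y = 0, that is the loci
   u * (x^2 + y^2) + v * x + w = 0; hence [r |-> turn p q r] vanishes exactly on
   the geodesic through p != q, and it is positive exactly on the open
   half-plane to the left of that geodesic directed from p to q. *)
Definition turn p q r : R :=
  (q.1 - p.1) * ((r.1 ^+ 2 + r.2 ^+ 2) - (p.1 ^+ 2 + p.2 ^+ 2))
  - (r.1 - p.1) * ((q.1 ^+ 2 + q.2 ^+ 2) - (p.1 ^+ 2 + p.2 ^+ 2)).

(* Polygons are given by their vertices v 0, ..., v (n - 1) in counterclockwise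
   order, the i-th side joining v i to v (i + 1 mod n).  Fixing the orientation
   loses no tuple of side lengths: reflections are isometries. *)
Definition convex_polygon n (v : 'I_n -> R * R) : Prop :=
  [/\ (3 <= n)%N,
      forall i, 0 < (v i).2 &
      forall i k, k != i -> k != ordS i -> 0 < turn (v i) (v (ordS i)) (v k)].

Definition circumcenter n (v : 'I_n -> R * R) c : Prop :=
  0 < c.2 /\ exists rho : R, forall i, hdist c (v i) = rho.

Definition cyclic_polygon n (v : 'I_n -> R * R) : Prop :=
  convex_polygon v /\ exists c, circumcenter v c.

Definition side_lengths n (v : 'I_n -> R * R) : seq R :=
  [seq hdist (v i) (v (ordS i)) | i <- enum 'I_n].

(* The polygon as a closed region: the intersection of its half-planes. *)
Definition polygon_region n (v : 'I_n -> R * R) : set (R * R) :=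
  [set p | 0 < p.2 /\ forall i, 0 <= turn (v i) (v (ordS i)) p].

Definition hsegment p q : set (R * R) :=
  [set r | 0 < r.2 /\ hdist p r + hdist r q = hdist p q].

Definition AC : set (seq R) :=
  [set s | exists n (v : 'I_n -> R * R),
     cyclic_polygon v /\ side_lengths v = s].

Definition BC : set (seq R) :=
  [set s | exists n (v : 'I_n -> R * R),
     [/\ cyclic_polygon v, side_lengths v = s &
         exists c i, circumcenter v c /\ hsegment (v i) (v (ordS i)) c]].

(* Meaningful for s in AC, where the area depends only on s. *)
Definition D0 s : R :=
  xget 0 [set A | exists n (v : 'I_n -> R * R),
     [/\ cyclic_polygon v, side_lengths v = s & A = harea (polygon_region v)]].

Definition b0 s : R :=
  xget 0 [set b | (forall x, x \in s -> x < b) /\ BC (b :: s)].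

Definition Am (d : R) : R := D0 [:: d; d; b0 [:: d; d]].

End Hyperbolic.

(** * Rooted trees with a frontier

    Trees matter up to isomorphism, so the vertices are taken to be the elements
    of some 'I_m.  An edge of the tree is the set of its two vertices.  The
    frontier edges are enumerated by 'I_n; as each has exactly one vertex in the
    tree, the frontier is given by the map sending a frontier edge to it. *)

Record frontier_graph (n : nat) := FrontierGraph {
  nvertices : nat;
  tree_edges : {set {set 'I_nvertices}};
  tree_root : 'I_nvertices;
  foot : {ffun 'I_n -> 'I_nvertices}
}.

Section Trees.
Variables (n : nat) (T : frontier_graph n).
Notation V := 'I_(nvertices T).

Definition adj : rel V := fun x y => [set x; y]%SET \in tree_edges T.

(* x :: s is the sequence of vertices of an arc from x to y. *)
Definition tree_arc (x : V) (s : seq V) (y : V) : bool :=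
  [&& path adj x s, uniq (x :: s) & last x s == y].

Definition is_tree : Prop :=
  (forall a, a \in tree_edges T -> #|a| = 2%N) /\
  (forall x y, exists! s, tree_arc x s y).

Definition edge : finType := ({set V} + 'I_n)%type.

Definition edges_at (v : V) : {set edge} :=
  [set e : edge | match e with
                  | inl a => (a \in tree_edges T) && (v \in a)
                  | inr f => foot T f == v
                  end]%SET.

Definition trivalent_tree : Prop :=
  is_tree /\ forall v, #|edges_at v| = 3%N.

(* The first edge of the arc from v to the root. *)
Definition initial_edge (v : V) (e : edge) : Prop :=
  exists u s, tree_arc v (u :: s) (tree_root T) /\ e = inl [set v; u]%SET.

Section Labels.
Context {R : realType}.
Implicit Types (bF : {ffun 'I_n -> R}) (b : {ffun edge -> R}).

Definition labels b (A : {set edge}) : seq R := [seq b e | e <- enum A].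

(* b = (b_E, b_F) with b_E given by the recursion toward the root; the values
   of b at the vertex sets that are not edges of T play no role. *)
Definition extends_to_edges bF b : Prop :=
  (forall f, b (inr f) = bF f) /\
  (forall v e, v != tree_root T -> initial_edge v e ->
     b e = b0 (labels b (edges_at v :\ e)%SET)).

(* Only a largest label at the root, the head of s, is truncated. *)
Definition root_area b : R :=
  let s := sort >=%R (labels b (edges_at (tree_root T))) in
  D0 (Num.min (head 0 s) (b0 (behead s)) :: behead s).

Definition BT bF : R :=
  xget 0 [set x | exists b, extends_to_edges bF b /\
    x = root_area b + \sum_(v | v != tree_root T) D0 (labels b (edges_at v))].

End Labels.
End Trees.

Section Minimum.
Context {R : realType}.

Definition is_minimum (S : set R) (m : R) : Prop := S m /\ lbound S m.

Definition BT_values n (b : {ffun 'I_n -> R}) : set R :=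
  [set x | exists (T : frontier_graph n) (sigma : 'S_n),
     trivalent_tree T /\ x = BT T [ffun i => b (sigma i)]].

Definition beta n (d : R) : R :=
  xget 0 (is_minimum (BT_values [ffun _ : 'I_n => d])).

End Minimum.

(* Main.v *)
Require Import Defs.
From mathcomp Require Import all_boot all_order all_algebra all_fingroup.
From mathcomp Require Import all_classical all_reals all_analysis.
From mathcomp Require Import measurable_realfun ring lra zify.

(** Write [A = sinh (a / 2) ^+ 2] for a side [a].

    Area.  In the coordinates [(x, x ^+ 2 + y ^+ 2)] geodesics become straight
    lines, so the vertical sections of a geodesic triangle are intervals; since
    [1 / y] integrates along the geodesic from [p] to [q] to
    [2 * atan ((q.1 - p.1) / (p.2 + q.2))], the area is a sum of three arctangents,
    and the cosine of half of it is
    [(2 + A + B + C) / (2 * sqrt ((1 + A) * (1 + B) * (1 + C)))].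

    Semicyclic triangles.  Their sides satisfy Pythagoras' theorem [A = B + C], so
    [b0 [:: x; y]] is larger than [x] and [y], and edges of a tree all of whose
    frontier edges have length [d] carry labels with [A >= 2 * D].

    Monotonicity.  While [C <= A + B], increasing [C] increases the area.  Hence a
    nonobtuse triangle with [B, C >= D] and largest side [A >= 2 * D] has area at
    least [Am d], strictly if [B > D].  For [n >= 4] each of the [n - 2] vertices
    of the tree carries such a triangle.  If there are three vertices or more, then either some
    vertex other than the root has a child or the root has two children; this vertex
    gives a strict inequality. *)

Set Implicit Arguments.
Unset Strict Implicit.
Unset Printing Implicit Defensive.

Import Order.TTheory GRing.Theory Num.Theory.
Import numFieldNormedType.Exports.
Local Open Scope classical_set_scope.
Local Open Scope ring_scope.

(** * Areas of geodesic triangles *)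

Section GeodesicIntegrals.
Context {R : realType}.
Notation mu := (@lebesgue_measure R).

Lemma integral_is_derive (F f : R -> R) (a b : R) : a <= b ->
    (forall x : R, x \in `[a, b] -> is_derive x 1 F (f x)) ->
    (forall x : R, x \in `[a, b] -> {for x, continuous f}) ->
  (\int[mu]_(x in `[a, b]) (f x)%:E = (F b - F a)%:E)%E.
Proof.
rewrite le_eqVlt => /predU1P[<- _ _|ab dF cf].
  by rewrite set_itv1 integral_set1 subrr.
have cF x : x \in `[a, b] -> {for x, continuous F}.
  by move=> /dF xF; apply/differentiable_continuous/derivable1_diffP/ex_derive.
have aab : a \in `[a, b] by rewrite in_itv/= lexx ltW.
have bab : b \in `[a, b] by rewrite in_itv/= lexx ltW.
rewrite (@continuous_FTC2 _ f F)// ?EFinB//.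
- by apply: continuous_in_subspaceT => x; rewrite inE => xab; exact: cf.
- split.
  + by move=> x xab; apply: (@ex_derive _ _ _ _ _ _ _ (dF x _)); exact: subset_itv_oo_cc.
  + by apply: cvg_at_right_filter; exact: cF.
  + by apply: cvg_at_left_filter; exact: cF.
- move=> x xab; have /dF xF : x \in `[a, b] by exact: subset_itv_oo_cc.
  by rewrite derive1E derive_val.
Qed.

Lemma integral_inv_sqr (l h : R) : 0 < l -> l <= h ->
  (\int[mu]_(y in `[l, h]) (y ^- 2)%:E = (l^-1 - h^-1)%:E)%E.
Proof.
move=> l0 lh.
have pos x : x \in `[l, h] -> 0 < x by rewrite in_itv/= => /andP[+ _]; exact: lt_le_trans.
have dF x : x \in `[l, h] -> is_derive x 1 (fun y : R => - y^-1) (x ^- 2).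
  move=> /pos x0; apply: is_derive_eq.
    by apply: is_deriveN; apply: is_deriveV; rewrite gt_eqF.
  by rewrite scaleNr opprK /GRing.scale /= mulr1.
have cf x : x \in `[l, h] -> {for x, continuous (fun y : R => y ^- 2)}.
  move=> /pos x0; apply: cvgV; first by rewrite expf_neq0// gt_eqF.
  exact: exprn_continuous.
by rewrite (integral_is_derive lh dF cf); congr EFin; ring.
Qed.

(* Heights are measured on the geodesic [x ^+ 2 + y ^+ 2 = a + m * x]. *)
Definition height (a m x : R) : R := Num.sqrt (a + m * x - x ^+ 2).

(* The Euclidean centre of the geodesic through [p] and [q] sees the arc between
   them under the angle [2 * atan (half_angle p q)]. *)
Definition half_angle (p q : R * R) : R := (q.1 - p.1) / (p.2 + q.2).

Lemma half_angleC p q : half_angle q p = - half_angle p q.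
Proof. by rewrite /half_angle [q.2 + _]addrC -mulNr opprB. Qed.

Lemma is_derive_height (a m x : R) : 0 < a + m * x - x ^+ 2 ->
  is_derive x 1 (height a m) ((m - 2 * x) / (2 * height a m x)).
Proof.
move=> x0.
have := @is_derive1_comp R (@Num.sqrt R) (fun x => a + m * x - x ^+ 2) x _ _
  (is_derive1_sqrt x0).
move=> /(_ (m - 2 * x)) H.
apply: is_derive_eq.
  apply: H.
  apply: is_derive_eq.
  by rewrite /GRing.scale /=; ring.
by rewrite /height mulrC.
Qed.

(** Put [x = m / 2 + rho * sin t] and [height a m x = rho * cos t], with [rho] the Euclidean radius
    of the geodesic. Then [dx / height = dt], and the function differentiated is [t] minus its value
    at [p], because the tangent of half the difference of [t] and [t'] is
    [(sin t - sin t') / (cos t + cos t')]. *)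
Lemma is_derive_angle (a m x : R) (p : R * R) :
    0 < p.2 -> p.1 ^+ 2 + p.2 ^+ 2 = a + m * p.1 -> 0 < a + m * x - x ^+ 2 ->
  is_derive x 1 (fun x => 2 * atan (half_angle p (x, height a m x)))
    (height a m x)^-1.
Proof.
move=> p2 pE x0; have dh := is_derive_height x0.
have h0 : 0 < height a m x by rewrite sqrtr_gt0.
have h2 : height a m x ^+ 2 = a + m * x - x ^+ 2 by rewrite sqr_sqrtr// ltW.
have ph0 : p.2 + height a m x != 0 by rewrite gt_eqF// addr_gt0.
pose g z : R := (z - p.1) * (p.2 + height a m z)^-1.
have dg : is_derive x 1 g ((p.2 + height a m x - (x - p.1) *
    ((m - 2 * x) / (2 * height a m x))) / (p.2 + height a m x) ^+ 2).
  have dn : is_derive x 1 (fun z => z - p.1) 1.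
    by apply: is_derive_eq; exact: subr0.
  have dd : is_derive x 1 (fun z => p.2 + height a m z) ((m - 2 * x) / (2 * height a m x)).
    by apply: is_derive_eq; rewrite add0r mul1r.
  have ddV := @is_deriveV R (fun z => p.2 + height a m z) x _ _ ph0 dd.
  have := is_deriveM dn ddV; move/is_derive_eq; apply.
  rewrite /GRing.scale /=; field.
  by rewrite ph0 gt_eqF.
have dag := @is_derive1_comp R _ g x _ _ (is_derive1_atan (g x)) dg.
have := @is_deriveZ R R R (atan \o g) 2 x 1 _ dag.
move/is_derive_eq; apply.
rewrite /g /GRing.scale /=.
move: (height a m x) h0 h2 ph0 => h h0 h2 ph0.
have ? : (p.2 + h) ^+ 2 + (x - p.1) ^+ 2 != 0.
  by rewrite gt_eqF// ltr_wpDr ?sqr_ge0// exprn_gt0// addr_gt0.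
transitivity ((2 * (p.2 + h) * h - (x - p.1) * (m - 2 * x)) /
    (((p.2 + h) ^+ 2 + (x - p.1) ^+ 2) * h)).
  by field; apply/and3P; split=> //; rewrite gt_eqF.
(* Subtracting the equations of the geodesic at [p] and at [(x, h)] eliminates [a] and [m]. *)
have -> : 2 * (p.2 + h) * h - (x - p.1) * (m - 2 * x) =
    (p.2 + h) ^+ 2 + (x - p.1) ^+ 2.
  lra.
by rewrite invfM mulrA divff// mul1r.
Qed.

Definition section_area (S : set (R * R)) (x : R) : \bar R :=
  (\int[mu]_y ((fun z : R * R => (z.2 ^- 2)%:E) \_ S) (x, y))%E.

Definition angle_to (p : R * R) (a m x : R) : R :=
  2 * atan (half_angle p (x, height a m x)).

(** The vertical section at [x] runs from the lower to the upper geodesic, and [y ^- 2] integrates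
    over it to the difference of the inverse heights, whose primitives are the angles along the two
    geodesics. The points [p] and [p'] only serve as origins of these angles. *)
Lemma integral_slab (S : set (R * R)) (l r a m a' m' : R) (p p' : R * R) :
    l <= r -> 0 < p.2 -> 0 < p'.2 ->
    p.1 ^+ 2 + p.2 ^+ 2 = a + m * p.1 ->
    p'.1 ^+ 2 + p'.2 ^+ 2 = a' + m' * p'.1 ->
    (forall x, l <= x <= r -> 0 < a + m * x - x ^+ 2) ->
    (forall x, l <= x <= r -> 0 < a' + m' * x - x ^+ 2) ->
    (forall x, l < x < r -> a + m * x <= a' + m' * x) ->
    (forall x y, l < x < r ->
      S (x, y) <-> 0 < y /\ a + m * x <= x ^+ 2 + y ^+ 2 <= a' + m' * x) ->
  (\int[mu]_(x in `]l, r[) section_area S x =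
   ((angle_to p a m r - angle_to p a m l) -
    (angle_to p' a' m' r - angle_to p' a' m' l))%:E)%E.
Proof.
move=> lr p2 p'2 pE p'E rad rad' le_rad SE.
have dA x : x \in `[l, r] -> is_derive x 1
    (fun x => angle_to p a m x - angle_to p' a' m' x)
    ((height a m x)^-1 - (height a' m' x)^-1).
  rewrite in_itv => /= xlr.
  have d1 := is_derive_angle p2 pE (rad _ xlr).
  have d2 := is_derive_angle p'2 p'E (rad' _ xlr).
  exact: is_deriveB.
have cA x : x \in `[l, r] ->
    {for x, continuous (fun x => (height a m x)^-1 - (height a' m' x)^-1)}.
  rewrite in_itv => /= xlr.
  have cV b n : 0 < b + n * x - x ^+ 2 -> {for x, continuous (fun x => (height b n x)^-1)}.
    move=> x0; apply: cvgV; first by rewrite gt_eqF// sqrtr_gt0.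
    have := is_derive_height x0 => dx.
    by apply/differentiable_continuous/derivable1_diffP/ex_derive.
  by apply: cvgB; apply: cV; [exact: rad|exact: rad'].
transitivity (\int[mu]_(x in `]l, r[)
    ((height a m x)^-1 - (height a' m' x)^-1)%:E)%E.
  apply: eq_integral => x; rewrite inE /= in_itv /= => xlr.
  have xlr' : l <= x <= r by move/andP: xlr => [/ltW-> /ltW->].
  rewrite -integral_inv_sqr.
  - rewrite [RHS]integral_mkcond; apply: eq_integral => y _.
    rewrite !patchE.
    have -> : ((x, y) \in S) = (y \in `[height a m x, height a' m' x]%classic); last by [].
    apply/idP/idP; rewrite !inE/= => H.
      move/(SE _ _ xlr) : H => [y0 /andP[H1 H2]].
      rewrite in_itv/= -(ger0_norm (ltW y0)) -sqrtr_sqr !ler_sqrt ?sqr_ge0//.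
        by rewrite lerBlDl lerBrDl H1 H2.
      by rewrite ltW// rad'.
    apply/(SE _ _ xlr).
    move: H; rewrite in_itv/= => /andP[H1 H2].
    have y0 : 0 < y by apply: lt_le_trans H1; rewrite sqrtr_gt0 rad.
    split=> //.
    move: H1 H2; rewrite -(ger0_norm (ltW y0)) -sqrtr_sqr !ler_sqrt ?sqr_ge0//;
      last by rewrite ltW// rad'.
    by rewrite sqr_sqrtr ?sqr_ge0// lerBlDl lerBrDl => -> ->.
  - by rewrite sqrtr_gt0 rad.
  - by rewrite ler_sqrt ?lerD2r ?le_rad// ltW// rad'.
have mf : measurable_fun `]l, r[ (fun x => (height a m x)^-1 - (height a' m' x)^-1).
  apply: open_continuous_measurable_fun; first exact: interval_open.
  by move=> x; rewrite inE/= => xlr; apply: cA; exact: subset_itv_oo_cc.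
rewrite -(@integral_itv_bndoo _ l r _ true false); last exact/measurable_EFinP.
rewrite (integral_is_derive lr dA cA); congr EFin; ring.
Qed.
End GeodesicIntegrals.

(** * Areas by integration over vertical sections *)

Section VerticalSections.
Context {R : realType}.
Notation mu := (@lebesgue_measure R).

Definition triangle (p q r : R * R) : set (R * R) :=
  [set z | 0 < z.2 /\ [/\ 0 <= turn p q z, 0 <= turn q r z & 0 <= turn r p z]].

Lemma measurable_turn (p q : R * R) : measurable_fun setT (turn p q).
Proof.
rewrite /turn.
have m1 : measurable_fun setT (fun r : R * R => r.1) by exact: measurable_fst.
have m2 : measurable_fun setT (fun r : R * R => r.2) by exact: measurable_snd.
apply: measurable_funB; apply: measurable_funM => //.
- by apply: measurable_funB => //; apply: measurable_funD; exact: measurable_funX.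
- exact: measurable_funB.
Qed.

Lemma measurable_triangle (p q r : R * R) : measurable (triangle p q r).
Proof.
have mt (f : R * R -> R) : measurable_fun setT f -> measurable [set z | 0 <= f z].
  move=> mf; rewrite (_ : [set z | _] = setT `&` f @^-1` `[0, +oo[).
    by apply: mf => //; exact: measurable_itv.
  by apply/seteqP; split=> z /=; rewrite in_itv/= andbT // => -[].
rewrite (_ : triangle p q r = [set z : R * R | 0 < z.2] `&` ([set z | 0 <= turn p q z] `&`
   ([set z | 0 <= turn q r z] `&` [set z | 0 <= turn r p z]))).
  apply: measurableI; last first.
    by apply: measurableI; [|apply: measurableI]; apply: mt; exact: measurable_turn.
  rewrite (_ : [set z | _] = setT `&` (@snd R R) @^-1` `]0, +oo[).
    by apply: (@measurable_snd _ _ R R) => //; exact: measurable_itv.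
  by apply/seteqP; split=> z /=; rewrite in_itv/= andbT // => -[].
by apply/seteqP; split=> z /= [z0 H]; split=> //; case: H => ? //; case.
Qed.

Section Fubini.
Variable S : set (R * R).
Hypothesis mS : measurable S.
Hypothesis S0 : forall z, S z -> 0 < z.2.

Let f : R * R -> \bar R := (fun z : R * R => (z.2 ^- 2)%:E) \_ S.

Let mf : measurable_fun setT f.
Proof.
have mV : measurable_fun (`]0, +oo[%classic : set R) (fun y : R => y ^- 2).
  apply: open_continuous_measurable_fun; first exact: interval_open.
  move=> x; rewrite inE/= in_itv/= andbT => x0; apply: cvgV.
    by rewrite expf_neq0// gt_eqF.
  exact: exprn_continuous.
have mg : measurable_fun S (fun z : R * R => z.2 ^- 2).
  apply: (@measurable_comp _ _ _ (R * R)%type R R `]0, +oo[%classic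
    (fun y : R => y ^- 2) S snd _ _ mV).
  - exact: measurable_itv.
  - by move=> _ [z /S0 z0 <-] /=; rewrite in_itv/= z0.
  - by apply: measurable_funS (@measurable_snd _ _ R R).
apply: (measurable_restrictT _ mS).1.
exact/measurable_EFinP.
Qed.

Let f0 z : (0 <= f z)%E.
Proof.
rewrite /f patchE; case: ifPn => // _.
by rewrite lee_fin invr_ge0 sqr_ge0.
Qed.

Lemma measurable_section_area : measurable_fun setT (section_area S).
Proof. have H := (@measurable_fun_fubini_tonelli_F _ _ _ _ R mu _ mf f0). exact: H. Qed.

Lemma section_area_ge0 x : (0 <= section_area S x)%E.
Proof. by apply: integral_ge0 => y _; exact: f0. Qed.

Lemma harea_section : harea S = fine (\int[mu]_x section_area S x)%E.
Proof.
rewrite /harea /Rintegral integral_mkcond.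
by rewrite (@fubini_tonelli1 _ _ _ _ _ mu mu _ mf f0).
Qed.

(** With [b] the abscissa of the middle vertex of a triangle, each of the two pieces lies between
    one geodesic below and one above. The vertical lines at [a], [b] and [c] are negligible. *)
Lemma harea_split (a b c : R) : a <= b <= c ->
    (forall z, S z -> a <= z.1 <= c) ->
  harea S = fine (\int[mu]_(x in `]a, b[) section_area S x +
                  \int[mu]_(x in `]b, c[) section_area S x)%E.
Proof.
move=> /andP[ab bc] Sac; rewrite harea_section; congr fine.
have ms D : measurable_fun D (section_area S).
  exact: measurable_funS measurable_section_area.
transitivity (\int[mu]_(x in `[a, c]) section_area S x)%E.
  rewrite [RHS]integral_mkcond; apply: eq_integral => x _.
  rewrite patchE; case: ifPn => //; rewrite notin_setE /= in_itv/= => xac.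
  apply: integral0_eq => y _; rewrite patchE ifF//.
  by apply/negbTE; rewrite notin_setE => /Sac /= /xac.
rewrite -(@integral_itv_bndoo _ a b _ true false)//.
rewrite -(@integral_itv_bndoo _ b c _ false false)//.
have -> : `[a, c]%classic = `[a, b]%classic `|` `]b, c]%classic.
  apply: (@itv_bndbnd_setU _ _ (BLeft a) (BRight b) (BRight c)); by rewrite bnd_simp.
apply: ge0_integral_setU => //.
- exact: ms.
- by move=> x _; exact: section_area_ge0.
- rewrite disj_set2E; apply/eqP/seteqP; split=> // x /=.
  by rewrite !in_itv/= => -[/andP[_ xb] /andP[bx _]]; move: bx; rewrite ltNge xb.
Qed.
End Fubini.
End VerticalSections.

(** * The area of a geodesic triangle as a sum of arctangents *)

Section GeodesicTriangles.
Context {R : realType}.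
Notation mu := (@lebesgue_measure R).
Section Lines.
Implicit Types p q r z : R * R.

(** The line meant here is the image of the geodesic through [p] and [q] in the coordinates
    [(x, x ^+ 2 + y ^+ 2)]. *)
Definition slope p q : R :=
  ((q.1 ^+ 2 + q.2 ^+ 2) - (p.1 ^+ 2 + p.2 ^+ 2)) / (q.1 - p.1).

Definition intercept p q : R := p.1 ^+ 2 + p.2 ^+ 2 - slope p q * p.1.

Lemma line_start p q : p.1 ^+ 2 + p.2 ^+ 2 = intercept p q + slope p q * p.1.
Proof. by rewrite /intercept subrK. Qed.

Lemma line_end p q : p.1 < q.1 ->
  q.1 ^+ 2 + q.2 ^+ 2 = intercept p q + slope p q * q.1.
Proof.
rewrite /intercept /slope; case: p q => [p1 p2] [q1 q2] /= pq; field.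
by rewrite subr_eq0 gt_eqF.
Qed.

(** The squared height is the linear interpolation of [p.2 ^+ 2] and [q.2 ^+ 2] plus the nonnegative
    term [(x - p.1) * (q.1 - x)]. *)
Lemma line_gt p q x : 0 < p.2 -> 0 < q.2 -> p.1 < q.1 -> p.1 <= x <= q.1 ->
  0 < intercept p q + slope p q * x - x ^+ 2.
Proof.
move=> p0 q0 pq /andP[px xq].
have -> : intercept p q + slope p q * x - x ^+ 2 =
  ((q.1 - x) * p.2 ^+ 2 + (x - p.1) * q.2 ^+ 2) / (q.1 - p.1) + (x - p.1) * (q.1 - x).
  rewrite /intercept /slope; case: p q {p0 q0 px xq} pq => [p1 p2] [q1 q2] /= pq; field.
  by rewrite subr_eq0 gt_eqF.
apply: ltr_wpDr; first by rewrite mulr_ge0 ?subr_ge0.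
rewrite divr_gt0 ?subr_gt0//.
have [xp|xp] := eqVneq x p.1.
  by rewrite xp subrr mul0r addr0 mulr_gt0 ?subr_gt0 ?exprn_gt0.
apply: ltr_wpDl; first by rewrite mulr_ge0 ?subr_ge0 ?sqr_ge0.
by rewrite mulr_gt0 ?exprn_gt0// subr_gt0 lt_neqAle eq_sym xp.
Qed.

Lemma turn_line p q z : p.1 < q.1 ->
  turn p q z = (q.1 - p.1) * (z.1 ^+ 2 + z.2 ^+ 2 - (intercept p q + slope p q * z.1)).
Proof.
rewrite /turn /intercept /slope; case: p q => [p1 p2] [q1 q2] /= pq; field.
by rewrite subr_eq0 gt_eqF.
Qed.

Lemma turnC p q z : turn q p z = - turn p q z.
Proof. by rewrite /turn; ring. Qed.

Lemma turn_rot p q r : turn q r p = turn p q r.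
Proof. by rewrite /turn; ring. Qed.

(** With the next lemma, this says that the three turns at [z], divided by [turn p q r], are
    barycentric coordinates of [z] in the plane of [(x, x ^+ 2 + y ^+ 2)]. *)
Lemma turn_sum p q r z : turn p q z + turn q r z + turn r p z = turn p q r.
Proof. by rewrite /turn; ring. Qed.

Lemma turn_barycenter p q r z :
  p.1 * turn q r z + q.1 * turn r p z + r.1 * turn p q z = z.1 * turn p q r.
Proof. by rewrite /turn; ring. Qed.

Lemma turn_line_ge0 p q z : p.1 < q.1 ->
  (0 <= turn p q z) = (intercept p q + slope p q * z.1 <= z.1 ^+ 2 + z.2 ^+ 2).
Proof. by move=> pq; rewrite turn_line// pmulr_rge0 ?subr_gt0// subr_ge0. Qed.

Lemma turn_line_le0 p q z : p.1 < q.1 ->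
  (0 <= turn q p z) = (z.1 ^+ 2 + z.2 ^+ 2 <= intercept p q + slope p q * z.1).
Proof.
by move=> pq; rewrite turnC turn_line// oppr_ge0 pmulr_rle0 ?subr_gt0// subr_le0.
Qed.

Lemma height_end p q : 0 < q.2 -> p.1 < q.1 -> height (intercept p q) (slope p q) q.1 = q.2.
Proof. by move=> p0 pq; rewrite /height -line_end// addrC addKr sqrtr_sqr gtr0_norm. Qed.

Lemma angle_to_start p q : 0 < p.2 -> angle_to p (intercept p q) (slope p q) p.1 = 0.
Proof. by move=> p0; rewrite /angle_to /half_angle /= subrr mul0r atan0 mulr0. Qed.

Lemma angle_to_end p q : 0 < q.2 -> p.1 < q.1 ->
  angle_to p (intercept p q) (slope p q) q.1 = 2 * atan (half_angle p q).
Proof. by move=> p0 pq; rewrite /angle_to height_end// -surjective_pairing. Qed.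

Lemma half_angle_vert p q : p.1 = q.1 -> half_angle p q = 0.
Proof. by move=> pq; rewrite /half_angle pq subrr mul0r. Qed.

(** The two lines meet at [p], so the gap between them is proportional to [x - p.1], and its sign is
    that of [turn p q r]. *)
Lemma line_le_start p q r x : p.1 < q.1 -> p.1 < r.1 -> p.1 < x -> 0 < turn p q r ->
  intercept p q + slope p q * x <= intercept p r + slope p r * x.
Proof.
move=> pq pr px T0; rewrite -subr_ge0.
have -> : intercept p r + slope p r * x - (intercept p q + slope p q * x) =
    (x - p.1) * turn p q r / ((r.1 - p.1) * (q.1 - p.1)).
  move: pq pr; rewrite /turn /intercept /slope.
  case: p q r {px T0} => [p1 p2] [q1 q2] [r1 r2] /= pq pr; field.
  by rewrite !subr_eq0 !gt_eqF.
by apply: divr_ge0; apply: mulr_ge0; first [exact: ltW|rewrite subr_ge0; exact: ltW].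
Qed.

Lemma line_le_end p q r x : p.1 < r.1 -> q.1 < r.1 -> x < r.1 -> 0 < turn p q r ->
  intercept q r + slope q r * x <= intercept p r + slope p r * x.
Proof.
move=> pr qr xr T0; rewrite -subr_ge0.
have -> : intercept p r + slope p r * x - (intercept q r + slope q r * x) =
    (r.1 - x) * turn p q r / ((r.1 - p.1) * (r.1 - q.1)).
  move: pr qr; rewrite /turn /intercept /slope.
  case: p q r {xr T0} => [p1 p2] [q1 q2] [r1 r2] /= pr qr; field.
  by rewrite !subr_eq0 !gt_eqF.
by apply: divr_ge0; apply: mulr_ge0; first [exact: ltW|rewrite subr_ge0; exact: ltW].
Qed.

(** In the triangle the barycentric weights are nonnegative, so [z.1] is a weighted mean of the
    abscissae of the vertices. *)
Lemma triangle_within p q r z a b : 0 < turn p q r -> triangle p q r z ->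
  (forall t, t \in [:: p; q; r] -> a <= t.1 <= b) -> a <= z.1 <= b.
Proof.
move=> T0 [_ [pq qr rp]] H.
have /andP[? ?] := H p (mem_head _ _).
have /andP[? ?] := H q (mem_nth p (n:=1) (s:=[:: p; q; r]) isT).
have /andP[? ?] := H r (mem_nth p (n:=2) (s:=[:: p; q; r]) isT).
have S := turn_sum p q r z; have B := turn_barycenter p q r z.
rewrite -(ler_pM2r T0) -[X in _ && X](ler_pM2r T0) -B -S.
apply/andP; split; nra.
Qed.

(** Left of [q] and [r], the side from [q] to [r] imposes no further condition. Its turn is the
    weight of [p]; if it were negative, the weighted sum of the differences between the abscissae of
    the vertices and [x] would be positive, whereas it vanishes. *)
Lemma triangleP_left p q r x y : 0 < turn p q r ->
    p.1 < x -> x < q.1 -> x < r.1 ->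
  triangle p q r (x, y) <-> 0 < y /\ intercept p q + slope p q * x
     <= x ^+ 2 + y ^+ 2 <= intercept p r + slope p r * x.
Proof.
move=> T0 px xq xr.
have pq := lt_trans px xq; have pr := lt_trans px xr.
rewrite -(turn_line_ge0 (x, y) pq) -(turn_line_le0 (x, y) pr).
split=> [[/= y0 [-> _ ->]]//|[y0 /andP[tpq trp]]]; split=> //; split=> //.
have S := turn_sum p q r (x, y); have B := turn_barycenter p q r (x, y).
move: S B => /=.
move: (turn p q (x, y)) (turn q r (x, y)) (turn r p (x, y)) tpq trp => t1 t2 t3.
move=> ? ? S B.
rewrite leNgt; apply/negP => ?.
suff : 0 < t2 * (p.1 - x) + t3 * (q.1 - x) + t1 * (r.1 - x).
  rewrite -S in B. move=> H. have : (0:R) < 0; last by rewrite ltxx. move: H; congr (_ < _). 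
  transitivity (p.1 * t2 + q.1 * t3 + r.1 * t1 - x * (t1 + t2 + t3)); first by ring.
  by rewrite B subrr.
have : 0 < t2 * (p.1 - x) by nra.
have : 0 <= t3 * (q.1 - x) by nra.
have : 0 <= t1 * (r.1 - x) by nra.
lra.
Qed.

Lemma triangle_rot p q r : triangle q r p = triangle p q r.
Proof. by apply/seteqP; split=> z [z0 []]; split. Qed.

Lemma triangleP_right p q r x y : 0 < turn p q r ->
    p.1 < x -> q.1 < x -> x < r.1 ->
  triangle p q r (x, y) <-> 0 < y /\ intercept q r + slope q r * x
     <= x ^+ 2 + y ^+ 2 <= intercept p r + slope p r * x.
Proof.
move=> T0 px qx xr.
have pr := lt_trans px xr; have qr := lt_trans qx xr.
rewrite -(turn_line_ge0 (x, y) qr) -(turn_line_le0 (x, y) pr).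
split=> [[/= y0 [_ -> ->]]//|[y0 /andP[tqr trp]]]; split=> //; split=> //.
have S := turn_sum p q r (x, y); have B := turn_barycenter p q r (x, y).
move: S B => /=.
move: (turn p q (x, y)) (turn q r (x, y)) (turn r p (x, y)) tqr trp => t1 t2 t3.
move=> ? ? S B.
rewrite leNgt; apply/negP => ?.
have E : t2 * (p.1 - x) + t3 * (q.1 - x) + t1 * (r.1 - x) = 0.
  transitivity (p.1 * t2 + q.1 * t3 + r.1 * t1 - x * (t1 + t2 + t3)); first by ring.
  by rewrite B S subrr.
have : 0 < t1 * (x - r.1) by nra.
have : 0 <= t3 * (x - q.1) by nra.
have : 0 <= t2 * (x - p.1) by nra.
lra.
Qed.

Lemma angle_to_last p q : 0 < q.2 -> p.1 <= q.1 ->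
  angle_to p (intercept p q) (slope p q) q.1 = 2 * atan (half_angle p q).
Proof.
rewrite le_eqVlt => q0 /predU1P[pq|]; last exact: angle_to_end.
(* On a vertical side [slope] divides by zero, but both angles have numerator zero, so the value of
   the slope does not matter. *)
by rewrite /angle_to !half_angle_vert.
Qed.

Lemma integral_left p q r b : 0 < p.2 -> 0 < q.2 -> 0 < r.2 -> 0 < turn p q r ->
    p.1 <= b -> b <= q.1 -> b <= r.1 ->
  (\int[mu]_(x in `]p.1, b[) section_area (triangle p q r) x =
   (angle_to p (intercept p q) (slope p q) b -
    angle_to p (intercept p r) (slope p r) b)%:E)%E.
Proof.
move=> p0 q0 r0 T0; rewrite le_eqVlt => /predU1P[<- _ _|pb bq br].
  by rewrite set_itvoo0 integral_set0 !angle_to_start// subrr.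
have pq := lt_le_trans pb bq; have pr := lt_le_trans pb br.
rewrite (@integral_slab _ _ _ _ (intercept p q) (slope p q) (intercept p r) (slope p r) p p).
- by rewrite !angle_to_start// !subr0.
- exact: ltW.
- exact: p0.
- exact: p0.
- exact: line_start.
- exact: line_start.
- by move=> x /andP[px xb]; apply: line_gt; rewrite // px (le_trans xb).
- by move=> x /andP[px xb]; apply: line_gt; rewrite // px (le_trans xb).
- by move=> x /andP[px xb]; apply: line_le_start.
- move=> x y /andP[px xb]; apply: triangleP_left => //; exact: lt_le_trans xb _.
Qed.

Lemma integral_right p q r b : 0 < p.2 -> 0 < q.2 -> 0 < r.2 -> 0 < turn p q r ->
    p.1 <= b -> q.1 <= b -> b <= r.1 ->
  (\int[mu]_(x in `]b, r.1[) section_area (triangle p q r) x =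
   ((2 * atan (half_angle q r) - angle_to q (intercept q r) (slope q r) b) -
    (2 * atan (half_angle p r) - angle_to p (intercept p r) (slope p r) b))%:E)%E.
Proof.
move=> p0 q0 r0 T0 pb qb; rewrite le_eqVlt => /predU1P[br|br].
  by rewrite br set_itvoo0 integral_set0 !angle_to_last -?br// !subrr.
have pr := le_lt_trans pb br; have qr := le_lt_trans qb br.
rewrite (@integral_slab _ _ _ _ (intercept q r) (slope q r) (intercept p r) (slope p r) q p).
- by rewrite !angle_to_end.
- exact: ltW.
- exact: q0.
- exact: p0.
- exact: line_start.
- exact: line_start.
- by move=> x /andP[bx xr]; apply: line_gt; rewrite // xr (le_trans _ bx).
- by move=> x /andP[bx xr]; apply: line_gt; rewrite // xr (le_trans _ bx).
- by move=> x /andP[bx xr]; apply: line_le_end.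
- by move=> x y /andP[bx xr]; apply: triangleP_right => //; apply: le_lt_trans bx.
Qed.

Definition triangle_area p q r : R :=
  2 * (atan (half_angle p q) + atan (half_angle q r) + atan (half_angle r p)).

Lemma triangle_area_rot p q r : triangle_area q r p = triangle_area p q r.
Proof. by rewrite /triangle_area; ring. Qed.

(** The side joining the leftmost and the rightmost vertex bounds both slabs. Its two angles add up,
    and their intermediate values at the middle vertex cancel. *)
Lemma harea_triangle p q r : 0 < p.2 -> 0 < q.2 -> 0 < r.2 -> 0 < turn p q r ->
  harea (triangle p q r) = triangle_area p q r.
Proof.
(* By rotating the names of the vertices, [p] may be taken leftmost. The middle vertex is then [q],
   below the long side, or [r], above it. *)
have main p' q' r' : 0 < p'.2 -> 0 < q'.2 -> 0 < r'.2 -> 0 < turn p' q' r' ->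
    p'.1 <= q'.1 -> p'.1 <= r'.1 -> harea (triangle p' q' r') = triangle_area p' q' r'.
  move: p' q' r' => {}p {}q {}r p0 q0 r0 T0 pq pr.
  have pos z : triangle p q r z -> 0 < z.2 by case.
  have [qr|/ltW rq] := leP q.1 r.1.
    rewrite (@harea_split _ _ (measurable_triangle p q r) pos p.1 q.1 r.1) ?pq//; last first.
      move=> z /(triangle_within T0); apply=> t.
      by rewrite !inE => /or3P[] /eqP->; rewrite ?lexx ?pq ?qr ?pr.
    rewrite integral_left// integral_right// (angle_to_last q0)//.
    rewrite (angle_to_start _ q0) -EFinD /=.
    rewrite /triangle_area [half_angle r p]half_angleC atanN; ring.
  rewrite (@harea_split _ _ (measurable_triangle p q r) pos p.1 r.1 q.1) ?pr//; last first.
    move=> z /(triangle_within T0); apply=> t.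
    by rewrite !inE => /or3P[] /eqP->; rewrite ?lexx ?pq ?rq ?pr.
  rewrite integral_left//.
  rewrite (triangle_rot r p q) integral_right//; last by rewrite -turn_rot.
  rewrite (angle_to_last r0)// (angle_to_start _ r0) -EFinD /=.
  rewrite /triangle_area [half_angle r p]half_angleC [half_angle q r]half_angleC !atanN; ring.
move=> p0 q0 r0 T0.
have [pq|/ltW qp] := leP p.1 q.1; have [pr|/ltW rp] := leP p.1 r.1.
- exact: main.
- rewrite -triangle_rot -triangle_area_rot -triangle_rot -triangle_area_rot.
  by apply: main => //; [rewrite -turn_rot|exact: le_trans rp pq].
- rewrite -triangle_rot -triangle_area_rot.
  by apply: main => //; [rewrite turn_rot|exact: le_trans qp pr].
- have [qr|/ltW rq] := leP q.1 r.1.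
    by rewrite -triangle_rot -triangle_area_rot; apply: main => //; rewrite turn_rot.
  rewrite -triangle_rot -triangle_area_rot -triangle_rot -triangle_area_rot.
  by apply: main => //; rewrite -turn_rot.
Qed.
End Lines.
End GeodesicTriangles.

(** * Distances and circumscribed circles *)

Section Hyperbolic.
Context {R : realType}.
Implicit Types (p q r c : R * R) (a d x : R).

(* [sq d] is [sinh (d / 2) ^+ 2]; [chord p q] is its value at [d = hdist p q]. *)
Definition sq d : R := (expR d + expR (- d) - 2) / 4.

Definition chord p q : R :=
  ((p.1 - q.1) ^+ 2 + (p.2 - q.2) ^+ 2) / (4 * p.2 * q.2).

Lemma sq0 : sq 0 = 0.
Proof. by rewrite /sq oppr0 expR0; lra. Qed.

(** The duplication formula of [sinh], squared. It compares a diameter of a circle with its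
    radius. *)
Lemma sq_double d : sq (d + d) = 4 * sq d * (1 + sq d).
Proof.
rewrite /sq expRN expRD expRN; set e := expR d.
have e0 : 0 < e := expR_gt0 d.
by field; rewrite gt_eqF.
Qed.

Lemma lt_sq : {in Num.nneg &, {mono sq : x y / x < y}}.
Proof.
apply: leW_mono_in.
apply: le_mono_in => x y; rewrite !nnegrE => x0 y0 xy.
rewrite /sq !expRN.
have e0 : 1 <= expR x by rewrite -expR0 ler_expR.
have exy : expR x < expR y by rewrite ltr_expR.
move: (expR x) (expR y) e0 exy => e f e0 ef.
rewrite -subr_gt0.
have -> : (f + f^-1 - 2) / 4 - (e + e^-1 - 2) / 4 = (f - e) * (e * f - 1) / (4 * e * f).
  field; apply/andP; split; rewrite gt_eqF//; lra.
have ef1 : 1 < e * f by nra.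
by rewrite divr_gt0 ?mulr_gt0 ?subr_gt0//; lra.
Qed.

Lemma le_sq x y : 0 <= x -> x <= y -> sq x <= sq y.
Proof.
move=> x0 xy; rewrite leNgt lt_sq -?leNgt// nnegrE //; exact: le_trans xy.
Qed.

Lemma sq_ge0 d : 0 <= d -> 0 <= sq d.
Proof. by move=> d0; rewrite -sq0 leNgt lt_sq ?nnegrE// -leNgt. Qed.

Lemma sq_gt0 d : 0 < d -> 0 < sq d.
Proof. by move=> d0; rewrite -sq0 lt_sq ?nnegrE// ltW. Qed.

Lemma sq_inj : {in Num.nneg &, injective sq}.
Proof.
move=> x y x0 y0 xy; case: (ltgtP x y) => // H.
  by move: (lt_sq x0 y0); rewrite xy ltxx H.
by move: (lt_sq y0 x0); rewrite xy ltxx H.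
Qed.

Lemma arcosh_ge0 x : 1 <= x -> 0 <= arcosh x.
Proof.
by move=> x1; rewrite /arcosh ln_ge0// (le_trans x1)// lerDl sqrtr_ge0.
Qed.

Lemma sq_arcosh x : 0 <= x -> sq (arcosh (1 + 2 * x)) = x.
Proof.
move=> x0; rewrite /sq /arcosh; set s := Num.sqrt _.
have s2 : s ^+ 2 = (1 + 2 * x) ^+ 2 - 1.
  by rewrite sqr_sqrtr//; nra.
have s0 : 0 <= s := sqrtr_ge0 _.
have e0 : 0 < 1 + 2 * x + s by lra.
rewrite expRN lnK ?posrE//.
have -> : (1 + 2 * x + s)^-1 = 1 + 2 * x - s.
  apply: (mulfI (lt0r_neq0 e0)); rewrite divff ?gt_eqF//.
  by transitivity ((1 + 2 * x) ^+ 2 - s ^+ 2); [rewrite s2; ring|ring].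
by field.
Qed.

Lemma hdistE p q : hdist p q = arcosh (1 + 2 * chord p q).
Proof.
rewrite /hdist /chord; congr (arcosh (1 + _)); set u := _ + _.
have -> : 4 * p.2 * q.2 = 2 * (2 * p.2 * q.2) by ring.
by rewrite [in RHS]invfM; move: (_^-1) => v; field.
Qed.

Lemma chordC p q : chord p q = chord q p.
Proof.
by rewrite /chord -sqrrN opprB -[(p.2 - _) ^+ 2]sqrrN opprB mulrAC.
Qed.

Lemma hdistC p q : hdist p q = hdist q p.
Proof. by rewrite !hdistE chordC. Qed.

Lemma chord_ge0 p q : 0 < p.2 -> 0 < q.2 -> 0 <= chord p q.
Proof.
by move=> p0 q0; rewrite divr_ge0 ?addr_ge0 ?sqr_ge0// !mulr_ge0// ltW.
Qed.

Lemma hdist_ge0 p q : 0 < p.2 -> 0 < q.2 -> 0 <= hdist p q.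
Proof.
move=> p0 q0; rewrite hdistE arcosh_ge0// lerDl mulr_ge0// chord_ge0//.
Qed.

Lemma sq_hdist p q : 0 < p.2 -> 0 < q.2 -> sq (hdist p q) = chord p q.
Proof. by move=> p0 q0; rewrite hdistE sq_arcosh ?chord_ge0. Qed.

Lemma hdist_eq p q d : 0 < p.2 -> 0 < q.2 -> 0 <= d -> chord p q = sq d ->
  hdist p q = d.
Proof.
move=> p0 q0 d0 pq; apply: sq_inj; rewrite ?nnegrE ?hdist_ge0//.
by rewrite sq_hdist.
Qed.

(** This is the polarized determinant of symmetric 2 by 2 matrices with entries [u.1.1], [u.1.2],
    [u.2], a form of signature (1, 2). The map [hyperboloid] below sends the half-plane to matrices
    of determinant one with positive first entry, and the form becomes the hyperbolic cosine of the
    distance. *)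
Let lorentz (u v : R * R * R) : R :=
  (u.1.1 * v.2 + u.2 * v.1.1) / 2 - u.1.2 * v.1.2.

Let hyperboloid p : R * R * R := (p.2^-1, p.1 / p.2, (p.1 ^+ 2 + p.2 ^+ 2) / p.2).

Let lorentz_hyperboloid p q : 0 < p.2 -> 0 < q.2 ->
  lorentz (hyperboloid p) (hyperboloid q) = 1 + 2 * chord p q.
Proof.
case: p q => [p1 p2] [q1 q2] /= p0 q0.
by rewrite /lorentz /chord /=; field; rewrite !gt_eqF.
Qed.

(* In the hyperboloid model antipodal points of a circle satisfy
   [X_p + X_q = 2 cosh(rho) X_c]: the difference of the two sides is null and
   orthogonal to the timelike vector [X_c]. *)
Let lorentz_antipodal (p q r c : R * R * R) (k : R) : 0 < c.1.1 ->
    lorentz p p = 1 -> lorentz q q = 1 -> lorentz c c = 1 ->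
    lorentz p q = 2 * k ^+ 2 - 1 ->
    lorentz c p = k -> lorentz c q = k -> lorentz c r = k ->
  lorentz p r + lorentz q r = 2 * k ^+ 2.
Proof.
move=> c0 pp qq cc pq cp cq cr.
pose w0 := p.1.1 + q.1.1 - 2 * k * c.1.1.
pose w1 := p.1.2 + q.1.2 - 2 * k * c.1.2.
pose w2 := p.2 + q.2 - 2 * k * c.2.
have wc : lorentz (w0, w1, w2) c = 0.
  transitivity (lorentz c p + lorentz c q - 2 * k * lorentz c c).
    by rewrite /lorentz /w0 /w1 /w2 /=; ring.
  by rewrite cp cq cc; ring.
have ww : lorentz (w0, w1, w2) (w0, w1, w2) = 0.
  transitivity (lorentz p p + lorentz q q + 4 * k ^+ 2 * lorentz c c +
      2 * lorentz p q - 4 * k * lorentz c p - 4 * k * lorentz c q).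
    by rewrite /lorentz /w0 /w1 /w2 /=; ring.
  by rewrite cp cq cc pp qq pq; ring.
have wr : lorentz p r + lorentz q r - 2 * k * lorentz c r = lorentz (w0, w1, w2) r.
  by rewrite /lorentz /w0 /w1 /w2 /=; ring.
suff w : [/\ w0 = 0, w1 = 0 & w2 = 0].
  case: w wr => -> -> ->; rewrite cr => E.
  apply/eqP; rewrite -subr_eq0; apply/eqP.
  transitivity (lorentz (0, 0, 0) r); first by rewrite -E; ring.
  by rewrite /lorentz /=; ring.
(* The form is negative definite on the orthogonal complement of [c]. This identity makes it
   explicit: the right-hand side vanishes because [w] is null and orthogonal to [c]. *)
have sos : (w0 * c.1.2 - w1 * c.1.1) ^+ 2 + w0 ^+ 2 = 0.
  transitivity (2 * w0 * c.1.1 * lorentz (w0, w1, w2) c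
     - c.1.1 ^+ 2 * lorentz (w0, w1, w2) (w0, w1, w2)
     + w0 ^+ 2 * (1 - lorentz c c)).
    by rewrite /lorentz /=; field.
  by rewrite wc ww cc; ring.
move/eqP: sos; rewrite paddr_eq0 ?sqr_ge0// !sqrf_eq0 => /andP[w10 /eqP w00].
move: w10; rewrite w00 mul0r sub0r oppr_eq0 mulf_eq0 (gt_eqF c0) orbF => /eqP w10.
move: wc; rewrite /lorentz /= w00 w10 !mul0r add0r subr0 => /eqP.
by rewrite !mulf_eq0 invr_eq0 pnatr_eq0 (gt_eqF c0) !orbF => /eqP.
Qed.

(** Thales and Pythagoras in hyperbolic form. With [k = 1 + 2 * chord c p] the hyperbolic cosine of
    the radius, the hypothesis on [chord p q] says that the distance from [p] to [q] is twice the
    radius, so [p] and [q] are antipodal. *)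
Lemma chord_pythagoras p q r c : 0 < p.2 -> 0 < q.2 -> 0 < r.2 -> 0 < c.2 ->
    chord p q = 4 * chord c p * (1 + chord c p) ->
    chord c q = chord c p -> chord c r = chord c p ->
  chord p q = chord p r + chord q r.
Proof.
move=> p0 q0 r0 c0 pq cq cr.
have pp z : chord z z = 0 by rewrite /chord !subrr expr0n /= addr0 mul0r.
have := @lorentz_antipodal (hyperboloid p) (hyperboloid q) (hyperboloid r)
  (hyperboloid c) (1 + 2 * chord c p).
rewrite !lorentz_hyperboloid// !pp /= invr_gt0 pq cq cr => /(_ c0).
rewrite mulr0 addr0 => /(_ erefl erefl erefl _ erefl erefl erefl) H.
have {}H := H ltac:(ring).
rewrite -pq; lra.
Qed.
End Hyperbolic.

(** * Construction of triangles inscribed in a circle about the point i *)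

Section Triangles.
Context {R : realType}.
Implicit Types (p q r z : R * R) (a b d x y : R).

(* Sixteen times the square of Heron's area. *)
Definition heron (a b c : R) : R :=
  2 * (a * b + b * c + c * a) - a ^+ 2 - b ^+ 2 - c ^+ 2.

(* The image of [i * l] under the rotation about [i] by twice the angle of
   cosine [c] and sine [s]. *)
Definition rotated (l c s : R) : R * R :=
  (c * s * (1 - l ^+ 2) / (c ^+ 2 + l ^+ 2 * s ^+ 2),
   l / (c ^+ 2 + l ^+ 2 * s ^+ 2)).

Lemma rotated_den_gt0 (l c s : R) : 0 < l -> c ^+ 2 + s ^+ 2 = 1 ->
  0 < c ^+ 2 + l ^+ 2 * s ^+ 2.
Proof.
move=> l0 cs.
have [s0|s0] := eqVneq s 0.
  by move: cs; rewrite s0 expr0n /= mulr0 !addr0 => ->.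
by apply: ltr_wpDl; rewrite ?sqr_ge0// mulr_gt0 ?exprn_even_gt0 ?(gt_eqF l0)// orbT.
Qed.

Lemma rotated_gt0 (l c s : R) : 0 < l -> c ^+ 2 + s ^+ 2 = 1 -> 0 < (rotated l c s).2.
Proof. by move=> l0 cs; rewrite /= divr_gt0 ?rotated_den_gt0. Qed.

(** Here [(l - l^-1) / 2] is the hyperbolic sine of the signed radius [ln l], and [c * s' - s * c']
    is the sine of half the central angle between the two points. *)
Lemma chord_rotated (l c s c' s' : R) : 0 < l ->
    c ^+ 2 + s ^+ 2 = 1 -> c' ^+ 2 + s' ^+ 2 = 1 ->
  chord (rotated l c s) (rotated l c' s') =
    ((l - l^-1) / 2) ^+ 2 * (c * s' - s * c') ^+ 2.
Proof.
move=> l0 cs cs'; rewrite /chord /=.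
have := rotated_den_gt0 l0 cs; have := rotated_den_gt0 l0 cs'.
have xE : c * s * (c' ^+ 2 + l ^+ 2 * s' ^+ 2) - c' * s' * (c ^+ 2 + l ^+ 2 * s ^+ 2) =
    (c * s' - s * c') * (l ^+ 2 * (s * s') - c * c') by ring.
have yE : (c' ^+ 2 + l ^+ 2 * s' ^+ 2) - (c ^+ 2 + l ^+ 2 * s ^+ 2) =
    (c * s' - s * c') * ((l ^+ 2 - 1) * (c * s' + s * c')).
  transitivity ((c ^+ 2 + s ^+ 2) * (c' ^+ 2 + l ^+ 2 * s' ^+ 2)
     - (c' ^+ 2 + s' ^+ 2) * (c ^+ 2 + l ^+ 2 * s ^+ 2)).
    by rewrite cs cs' !mul1r.
  by ring.
have DE : (l ^+ 2 * (s * s') - c * c') ^+ 2 + l ^+ 2 * (c * s' + s * c') ^+ 2 =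
  (c ^+ 2 + l ^+ 2 * s ^+ 2) * (c' ^+ 2 + l ^+ 2 * s' ^+ 2) by ring.
move: xE yE DE.
move: (c ^+ 2 + _) (c' ^+ 2 + _) => D D' xE yE DE D'0 D0.
have -> : c * s * (1 - l ^+ 2) / D - c' * s' * (1 - l ^+ 2) / D' =
    (1 - l ^+ 2) * (c * s * D' - c' * s' * D) / (D * D').
  by field; rewrite !gt_eqF.
have -> : l / D - l / D' = l * (D' - D) / (D * D').
  by field; rewrite !gt_eqF.
rewrite xE yE; move: (c * s' - s * c') => e.
transitivity ((l ^+ 2 - 1) ^+ 2 * e ^+ 2 *
  ((l ^+ 2 * (s * s') - c * c') ^+ 2 + l ^+ 2 * (c * s' + s * c') ^+ 2) /
  (4 * l ^+ 2 * (D * D'))).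
  move: (c * s' + s * c') (l ^+ 2 * (s * s') - c * c') => f g.
  by field; rewrite !gt_eqF.
rewrite DE.
by field; rewrite !gt_eqF.
Qed.

Lemma chord_center (l c s : R) : 0 < l -> c ^+ 2 + s ^+ 2 = 1 ->
  chord (0, 1) (rotated l c s) = (l - 1) ^+ 2 / (4 * l).
Proof.
move=> l0 cs; have D0 := rotated_den_gt0 l0 cs.
rewrite /chord /= sub0r sqrrN.
have nE : (c * s * (1 - l ^+ 2)) ^+ 2 + (c ^+ 2 + l ^+ 2 * s ^+ 2 - l) ^+ 2 =
    (l - 1) ^+ 2 * (c ^+ 2 + l ^+ 2 * s ^+ 2).
  have -> : c ^+ 2 = 1 - s ^+ 2 by lra.
  rewrite !exprMn; have -> : c ^+ 2 = 1 - s ^+ 2 by lra.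
  by ring.
move: D0 nE; move: (c ^+ 2 + _) => D D0 nE.
transitivity (((c * s * (1 - l ^+ 2)) ^+ 2 + (D - l) ^+ 2) / (4 * l * D)).
  by field; rewrite !gt_eqF.
by rewrite nE; field; rewrite !gt_eqF.
Qed.

(** Up to a positive factor the turn is the product of the sines of the three inscribed angles; the
    third of these is the supplement of the sum of the other two. *)
Lemma turn_rotated (l c s c' s' : R) : 1 < l ->
    c ^+ 2 + s ^+ 2 = 1 -> c' ^+ 2 + s' ^+ 2 = 1 ->
    0 < s -> 0 < s' -> 0 < c * s' + c' * s ->
  0 < turn (rotated l 1 0) (rotated l c s) (rotated l c' (- s')).
Proof.
move=> l1 cs cs' s0 s'0 cs0.
have l0 : 0 < l by exact: lt_trans l1.
have D0 := rotated_den_gt0 l0 cs; have D'0 := rotated_den_gt0 l0 cs'.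
have uE k t : k ^+ 2 + t ^+ 2 = 1 ->
    (rotated l k t).1 ^+ 2 + (rotated l k t).2 ^+ 2 - l ^+ 2 =
    t ^+ 2 * (1 - l ^+ 4) / (k ^+ 2 + l ^+ 2 * t ^+ 2).
  move=> kt; have := rotated_den_gt0 l0 kt; rewrite /=.
  have nE : (k * t * (1 - l ^+ 2)) ^+ 2 + l ^+ 2 - l ^+ 2 * (k ^+ 2 + l ^+ 2 * t ^+ 2) ^+ 2 =
      t ^+ 2 * (1 - l ^+ 4) * (k ^+ 2 + l ^+ 2 * t ^+ 2).
    rewrite !exprMn; have -> : k ^+ 2 = 1 - t ^+ 2 by lra.
    by ring.
  move: nE; move: (k ^+ 2 + _) => E nE E0.
  transitivity (((k * t * (1 - l ^+ 2)) ^+ 2 + l ^+ 2 - l ^+ 2 * E ^+ 2) / E ^+ 2).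
    by field; rewrite gt_eqF.
  by rewrite nE; field; rewrite gt_eqF.
have p1 : (rotated l 1 0).1 = 0 by rewrite /= mulr0 !mul0r.
have p2 : (rotated l 1 0).2 = l by rewrite /= expr0n /= mulr0 addr0 expr1n divr1.
have csN : c' ^+ 2 + (- s') ^+ 2 = 1 by rewrite sqrrN.
have z2 : 0 ^+ 2 = 0 :> R by rewrite expr0n.
rewrite /turn p1 p2 z2 add0r !subr0 (uE _ _ cs) (uE _ _ csN) /= sqrrN.
move: (c ^+ 2 + _) (c' ^+ 2 + _) D0 D'0 => D D' D0 D'0.
have -> : c * s * (1 - l ^+ 2) / D * (s' ^+ 2 * (1 - l ^+ 4) / D') -
   c' * - s' * (1 - l ^+ 2) / D' * (s ^+ 2 * (1 - l ^+ 4) / D) =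
   (l ^+ 2 - 1) * (l ^+ 4 - 1) * s * s' * (c * s' + c' * s) / (D * D').
  by field; rewrite !gt_eqF.
by rewrite divr_gt0 ?mulr_gt0// subr_gt0 exprn_egt1.
Qed.

(** On a circle of radius [rho], a chord of inscribed angle [g] satisfies
    [sinh (a / 2) = sinh rho * sin g]. Hence the square roots of [A], [B], [C] are the sides of a
    Euclidean triangle with circumdiameter [sinh rho], and Heron's formula gives [sinh rho ^+ 2 = 4
    * A * B * C / heron A B C]. The number [s] is [sinh (rho / 2) ^+ 2]. *)
Lemma exists_triangle (A B C : R) : 0 < A -> 0 < B -> 0 < C -> 0 < heron A B C ->
  exists p q r c,
   [/\ [/\ 0 < p.2, 0 < q.2, 0 < r.2 & 0 < c.2], 0 < turn p q r,
       [/\ chord p q = A, chord q r = B & chord r p = C] &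
       exists s, [/\ chord c p = s, chord c q = s, chord c r = s &
         4 * s * (1 + s) = 4 * A * B * C / heron A B C]].
Proof.
move=> A0 B0 C0 K0.
pose H := 4 * A * B * C / heron A B C.
have H0 : 0 < H by rewrite divr_gt0// !mulr_gt0.
(* The numbers [h], [t] and [l] are the hyperbolic sine, the hyperbolic cosine and the exponential
   of the circumradius. *)
pose h := Num.sqrt H; have h0 : 0 < h by rewrite sqrtr_gt0.
have h2 : h ^+ 2 = H by rewrite sqr_sqrtr// ltW.
pose t := Num.sqrt (1 + H); have t0 : 0 < t by rewrite sqrtr_gt0; lra.
have t2 : t ^+ 2 = 1 + H by rewrite sqr_sqrtr//; lra.
pose l := h + t.
have t1 : 1 <= t by rewrite -(@expr_ge1 _ 2)// ?t2; lra.
have l1 : 1 < l by rewrite /l; lra.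
have l0 : 0 < l by lra.
have lV : l^-1 = t - h.
  apply: (mulfI (lt0r_neq0 l0)); rewrite divff ?gt_eqF//.
  by transitivity (t ^+ 2 - h ^+ 2); [rewrite t2 h2; ring|rewrite /l; ring].
have lh : ((l - l^-1) / 2) ^+ 2 = H.
  by rewrite lV -h2; congr (_ ^+ 2); rewrite /l; field.
pose a := Num.sqrt A; pose b := Num.sqrt B; pose c := Num.sqrt C.
have a0 : 0 < a by rewrite sqrtr_gt0.
have b0 : 0 < b by rewrite sqrtr_gt0.
have c0 : 0 < c by rewrite sqrtr_gt0.
have a2 : a ^+ 2 = A by rewrite sqr_sqrtr// ltW.
have b2 : b ^+ 2 = B by rewrite sqr_sqrtr// ltW.
have c2 : c ^+ 2 = C by rewrite sqr_sqrtr// ltW.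
(* Sines and cosines of the inscribed angles opposite to [a] and [c], by the Euclidean laws of sines
   and cosines. *)
pose sg := a / h; pose sb := c / h.
pose cg := (B + C - A) / (2 * b * c); pose cb := (A + B - C) / (2 * a * b).
have sg0 : 0 < sg by rewrite divr_gt0.
have sb0 : 0 < sb by rewrite divr_gt0.
have sg2 : sg ^+ 2 = A / H by rewrite /sg expr_div_n a2 h2.
have sb2 : sb ^+ 2 = C / H by rewrite /sb expr_div_n c2 h2.
have csg : cg ^+ 2 + sg ^+ 2 = 1.
  rewrite sg2 /cg expr_div_n !exprMn b2 c2 /H.
  move: K0; rewrite /heron => K0.
  by field; rewrite !gt_eqF.
have csb : cb ^+ 2 + sb ^+ 2 = 1.
  rewrite sb2 /cb expr_div_n !exprMn a2 b2 /H.
  move: K0; rewrite /heron => K0.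
  by field; rewrite !gt_eqF.
have cs10 : 1 ^+ 2 + 0 ^+ 2 = 1 :> R by rewrite expr0n expr1n addr0.
have csN : cb ^+ 2 + (- sb) ^+ 2 = 1 by rewrite sqrrN.
have sbg : cg * sb + cb * sg = b / h.
  rewrite /cg /cb /sb /sg -b2 -a2 -c2.
  by field; rewrite !gt_eqF.
exists (rotated l 1 0), (rotated l cg sg), (rotated l cb (- sb)), (0, 1); split.
- by rewrite !rotated_gt0.
- by apply: turn_rotated => //; rewrite sbg divr_gt0.
- rewrite !chord_rotated// lh; split.
  + by rewrite mul1r mul0r subr0 sg2 mulrCA divff ?mulr1// gt_eqF.
  + have -> : cg * - sb - sg * cb = - (cg * sb + cb * sg) by ring.
    by rewrite sqrrN sbg expr_div_n b2 h2 mulrCA divff ?mulr1// gt_eqF.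
  + have -> : cb * 0 - - sb * 1 = sb by ring.
    by rewrite sb2 mulrCA divff ?mulr1// gt_eqF.
- exists ((l - 1) ^+ 2 / (4 * l)); rewrite !chord_center//; split=> //.
  rewrite -/H -lh.
  by field; rewrite gt_eqF.
Qed.
End Triangles.

(** * Areas of cyclic triangles *)

Section AreaFormula.
Context {R : realType}.
Implicit Types (p q r z : R * R) (x y : R).

Definition cos2_half_area (A B C : R) : R :=
  (2 + A + B + C) ^+ 2 / (4 * (1 + A) * (1 + B) * (1 + C)).

(** On the given range [cos (x / 2) ^+ 2] is strictly decreasing in [x], so the formula determines
    the area, and areas can be compared through it. *)
Definition is_area (A B C x : R) : Prop :=
  [/\ 0 <= x, x < pi & cos (x / 2) ^+ 2 = cos2_half_area A B C].

Lemma cos_atan_gt0 x : 0 < cos (atan x).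
Proof. by rewrite cos_gt0_pihalf// atan_gtNpi2 atan_ltpi2. Qed.

Lemma sin_atanE x : sin (atan x) = x * cos (atan x).
Proof. by rewrite -[X in X * _]atanK /tan divfK// gt_eqF// cos_atan_gt0. Qed.

Lemma sqr_cos_atan x : cos (atan x) ^+ 2 = (1 + x ^+ 2)^-1.
Proof. by rewrite cos_atan exprVn sqr_sqrtr// addr_ge0 ?sqr_ge0. Qed.

Lemma cos_atan3 x y t : cos (atan x + atan y + atan t) =
  cos (atan x) * cos (atan y) * cos (atan t) * (1 - x * y - y * t - t * x).
Proof. by rewrite !cosD sinD !sin_atanE; ring. Qed.

Lemma half_angle_sqr p q : 0 < p.2 -> 0 < q.2 ->
  1 + half_angle p q ^+ 2 = 4 * p.2 * q.2 * (1 + chord p q) / (p.2 + q.2) ^+ 2.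
Proof.
case: p q => [p1 p2] [q1 q2] /= p0 q0; rewrite /half_angle /chord /=.
by field; rewrite !gt_eqF// addr_gt0.
Qed.

Lemma half_angle_prod p q r : 0 < p.2 -> 0 < q.2 -> 0 < r.2 ->
  1 - half_angle p q * half_angle q r - half_angle q r * half_angle r p
    - half_angle r p * half_angle p q =
  (2 + chord p q + chord q r + chord r p) * (4 * p.2 * q.2 * r.2) /
  ((p.2 + q.2) * (q.2 + r.2) * (r.2 + p.2)).
Proof.
case: p q r => [p1 p2] [q1 q2] [r1 r2] /= p0 q0 r0; rewrite /half_angle /chord /=.
by field; rewrite !gt_eqF// addr_gt0.
Qed.

Lemma harea_ge0 (S : set (R * R)) : 0 <= harea S.
Proof.
by rewrite /harea Rintegral_ge0// => z _; rewrite invr_ge0 sqr_ge0.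
Qed.

Lemma is_area_harea p q r : 0 < p.2 -> 0 < q.2 -> 0 < r.2 -> 0 < turn p q r ->
  is_area (chord p q) (chord q r) (chord r p) (harea (triangle p q r)).
Proof.
move=> p0 q0 r0 T0.
have a0 := harea_ge0 (triangle p q r).
move: a0; rewrite harea_triangle//.
have chord0 := @chord_ge0 R.
set x := triangle_area p q r => a0.
have xE : x / 2 = atan (half_angle p q) + atan (half_angle q r) + atan (half_angle r p).
  by rewrite /x /triangle_area mulrAC divff ?mul1r.
have cpos : 0 < cos (x / 2).
  have pos : 0 < 2 + chord p q + chord q r + chord r p.
    have := chord0 _ _ p0 q0; have := chord0 _ _ q0 r0; have := chord0 _ _ r0 p0; lra.
  rewrite xE cos_atan3 half_angle_prod//; apply: mulr_gt0.
    by rewrite !mulr_gt0 ?cos_atan_gt0.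
  by apply: divr_gt0; [apply: mulr_gt0 => //|]; rewrite ?mulr_gt0 ?addr_gt0.
split=> //.
(* A sum of three arctangents is less than [3 * pi / 2], so [x / 2 >= pi / 2] would make its cosine
   nonpositive. *)
- rewrite ltNge; apply/negP => xpi.
  have : x / 2 < pi + pi / 2.
    rewrite xE.
    have := atan_ltpi2 (half_angle p q); have := atan_ltpi2 (half_angle q r).
    have := atan_ltpi2 (half_angle r p); move: (pi : R) => P; lra.
  move=> x3.
  have : 0 <= cos (x / 2 - pi).
    by rewrite cos_ge0_pihalf//; move: (pi : R) xpi x3 => P ? ?; lra.
  by rewrite cosB cospi sinpi mulrN1 mulr0 addr0 oppr_ge0 leNgt cpos.
- rewrite xE cos_atan3 half_angle_prod// !exprMn !sqr_cos_atan !half_angle_sqr//.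
  rewrite /cos2_half_area.
  have := chord0 _ _ p0 q0; have := chord0 _ _ q0 r0; have := chord0 _ _ r0 p0.
  move: (chord p q) (chord q r) (chord r p) p.2 q.2 r.2 p0 q0 r0 =>
    A B C y1 y2 y3 ? ? ? C0 B0 A0.
  by field; rewrite !gt_eqF//; lra.
Qed.

Lemma is_area_lt (A B C x A' B' C' y : R) : is_area A B C x -> is_area A' B' C' y ->
  (x < y) = (cos2_half_area A' B' C' < cos2_half_area A B C).
Proof.
move=> [x0 xpi <-] [y0 ypi <-].
have cos0 (z : R) : 0 <= z -> z < pi -> 0 <= cos (z / 2).
  move=> z0 zpi; apply: cos_ge0_pihalf; move: (pi : R) zpi => P ?; lra.
have in0 (z : R) : 0 <= z -> z < pi -> z / 2 \in `[0, pi].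
  by move=> z0 zpi; rewrite in_itv/=; move: (pi : R) zpi => P ?; apply/andP; split; lra.
by rewrite ltr_sqr ?nnegrE ?cos0// ltr_cos ?in0// ltr_pM2r.
Qed.

Lemma is_area_le (A B C x A' B' C' y : R) : is_area A B C x -> is_area A' B' C' y ->
  (x <= y) = (cos2_half_area A' B' C' <= cos2_half_area A B C).
Proof. by move=> xA yA; rewrite !leNgt (is_area_lt yA xA). Qed.

Lemma is_area_uniq (A B C x A' B' C' y : R) : is_area A B C x -> is_area A' B' C' y ->
  cos2_half_area A B C = cos2_half_area A' B' C' -> x = y.
Proof.
by move=> xA yA E; apply: le_anti; rewrite (is_area_le xA yA) (is_area_le yA xA) E lexx.
Qed.
End AreaFormula.

(** * The functions [D0] and [b0] on triangles *)

Section Polygons.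
Context {R : realType}.
Implicit Types (p q r z : R * R) (x y : R) (v : 'I_3 -> R * R).

Let i0 : 'I_3 := ord0.
Let i1 : 'I_3 := @Ordinal 3 1 isT.
Let i2 : 'I_3 := @Ordinal 3 2 isT.

Let enum3 : enum 'I_3 = [:: i0; i1; i2].
Proof. by apply: (inj_map val_inj); rewrite val_enum_ord. Qed.

Let ordS0 : ordS i0 = i1. Proof. exact: val_inj. Qed.
Let ordS1 : ordS i1 = i2. Proof. exact: val_inj. Qed.
Let ordS2 : ordS i2 = i0. Proof. exact: val_inj. Qed.

Let ord3P (P : 'I_3 -> Prop) : P i0 -> P i1 -> P i2 -> forall i, P i.
Proof.
move=> P0 P1 P2 [[|[|[|//]]] i3].
- by rewrite (_ : Ordinal _ = i0)//; exact: val_inj.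
- by rewrite (_ : Ordinal _ = i1)//; exact: val_inj.
- by rewrite (_ : Ordinal _ = i2)//; exact: val_inj.
Qed.

Let side_lengths3 v : side_lengths v =
  [:: hdist (v i0) (v i1); hdist (v i1) (v i2); hdist (v i2) (v i0)].
Proof. by rewrite /side_lengths enum3 /= ordS0 ordS1 ordS2. Qed.

Let convex3 v : convex_polygon v <->
  [/\ 0 < (v i0).2, 0 < (v i1).2, 0 < (v i2).2 & 0 < turn (v i0) (v i1) (v i2)].
Proof.
split=> [[_ pos T]|[p0 p1 p2 T]].
  by split=> //; have := T i0 i2; rewrite ordS0; apply.
split=> //; apply: ord3P => //; apply: ord3P => //; rewrite ?ordS0 ?ordS1 ?ordS2 => // _ _.
- by rewrite turn_rot.
- by rewrite -turn_rot.
Qed.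

Let region3 v : polygon_region v = triangle (v i0) (v i1) (v i2).
Proof.
apply/seteqP; split=> z /=.
  move=> [z0 T]; split=> //.
  by have := T i0; have := T i1; have := T i2; rewrite ordS0 ordS1 ordS2.
by move=> [z0 [T0 T1 T2]]; split=> //; apply: ord3P; rewrite ?ordS0 ?ordS1 ?ordS2.
Qed.

Let size_side_lengths n (w : 'I_n -> R * R) : size (side_lengths w) = n.
Proof. by rewrite size_map size_enum_ord. Qed.

Let cyclic_exists (a b c : R) : 0 < a -> 0 < b -> 0 < c ->
    0 < heron (sq a) (sq b) (sq c) ->
  exists v, [/\ cyclic_polygon v, side_lengths v = [:: a; b; c] &
    sq a = sq b + sq c ->
    exists w i, circumcenter v w /\ hsegment (v i) (v (ordS i)) w].
Proof.
move=> a0 b0 c0 /(exists_triangle (sq_gt0 a0) (sq_gt0 b0) (sq_gt0 c0)).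
move=> [p [q [r [w [[p0 q0 r0 w0] T [ab bc ca] [s [wp wq wr sE]]]]]]].
pose v (i : 'I_3) := nth p [:: p; q; r] i.
have sides : side_lengths v = [:: a; b; c].
  by rewrite side_lengths3 /=; congr [:: _; _; _]; apply: hdist_eq => //; exact: ltW.
have circ : circumcenter v w.
  split=> //; exists (hdist w p).
  by apply: ord3P => /=; rewrite !hdistE ?wp ?wq ?wr.
have conv : convex_polygon v by apply/convex3.
exists v; split=> //; first by split=> //; exists w.
move=> abc; exists w, i0; split=> //; rewrite ordS0 /= /hsegment /=.
split=> //; rewrite [hdist p w]hdistC [hdist w q]hdistE wq -wp -hdistE.
apply/esym/hdist_eq => //; first by rewrite addr_ge0// hdist_ge0.
(* For [A = B + C] the expression [heron A B C] equals [4 * B * C], so the circumradius formula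
   reads [sinh rho ^+ 2 = A] and the first side is a diameter. *)
rewrite sq_double sq_hdist// wp sE ab abc /heron.
have := sq_gt0 b0; have := sq_gt0 c0; move: (sq b) (sq c) => B C C0 B0.
field; rewrite !gt_eqF//=.
rewrite (_ : _ - _ = 4 * B * C); last by ring.
by rewrite !mulr_gt0.
Qed.

(** The side lengths fix the three chords and thereby the area, so it does not matter which polygon
    [D0] picks; [cyclic_exists] excludes the default value. *)
Lemma is_area_D0 (a b c : R) : 0 < a -> 0 < b -> 0 < c ->
    0 < heron (sq a) (sq b) (sq c) ->
  is_area (sq a) (sq b) (sq c) (D0 [:: a; b; c]).
Proof.
move=> a0 b0 c0 K0; rewrite /D0; case: xgetP => [x _ /=|none]; last first.
  have [v [v1 v2 _]] := cyclic_exists a0 b0 c0 K0.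
  by case: (none (harea (polygon_region v))); exists 3%N, v.
move=> [n [v [[conv _] sides ->]]].
have n3 : n = 3%N by rewrite -(size_side_lengths v) sides.
subst n; move/convex3: conv => [p0 p1 p2 T].
move: sides; rewrite side_lengths3 region3 => -[<- <- <-].
by rewrite !sq_hdist//; exact: is_area_harea.
Qed.

Lemma heron_pythagoras (A B C : R) : A = B + C -> heron A B C = 4 * B * C.
Proof. by move=> ->; rewrite /heron; ring. Qed.

(** The side containing the circumcentre is a diameter, so its chord is the sum of the other two.
    Conversely, a side defined by Pythagoras' theorem gives a semicyclic triangle, which excludes
    the default value. *)
Lemma b0P (x y : R) : 0 < x -> 0 < y ->
  [/\ x < b0 [:: x; y], y < b0 [:: x; y] & sq (b0 [:: x; y]) = sq x + sq y].
Proof.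
move=> x0 y0; rewrite /b0; case: xgetP => [b _ /=|none].
  move=> [bxy [n [v [[conv _] sides [w [i [[w0 [rho wE]] seg]]]]]]].
  have xb : x < b by apply: bxy; rewrite inE eqxx.
  have yb : y < b by apply: bxy; rewrite !inE eqxx orbT.
  split=> //.
  have n3 : n = 3%N by rewrite -(size_side_lengths v) sides.
  subst n; move/convex3: conv => [p0 p1 p2 T].
  have pos : forall j, 0 < (v j).2 by exact: ord3P.
  move: sides; rewrite side_lengths3 => -[bE xE yE].
  have ch j : chord w (v j) = sq rho by rewrite -sq_hdist// wE.
  have diam : chord (v i) (v (ordS i)) = 4 * sq rho * (1 + sq rho).
    by rewrite -sq_hdist// -seg.2 [hdist (v i) w]hdistC !wE sq_double.
  have pyth j : chord (v i) (v (ordS i)) = chord (v i) (v j) + chord (v (ordS i)) (v j).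
    by apply: (@chord_pythagoras _ _ _ _ w) => //; rewrite !ch.
  have sx := sq_ge0 (ltW x0); have sy := sq_ge0 (ltW y0).
  have sxb : sq x < sq b by rewrite lt_sq ?nnegrE ?ltW// (lt_trans x0).
  have syb : sq y < sq b by rewrite lt_sq ?nnegrE ?ltW// (lt_trans x0).
  have sb : sq b = chord (v i0) (v i1) by rewrite -bE sq_hdist.
  have sx' : sq x = chord (v i1) (v i2) by rewrite -xE sq_hdist.
  have sy' : sq y = chord (v i2) (v i0) by rewrite -yE sq_hdist.
  move: i {seg diam} pyth; apply: ord3P; rewrite ?ordS0 ?ordS1 ?ordS2.
  (* The three cases are the possible positions of the diameter; in the last two [x] or [y] would
     exceed [b]. *)
  - by move=> /(_ i2); rewrite sb sx' sy' [chord (v i0) (v i2)]chordC addrC.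
  - move=> /(_ i0); rewrite -sx' -sy' [chord (v i1) _]chordC -sb; lra.
  - move=> /(_ i1); rewrite -sy' -sb [chord (v i2) _]chordC -sx'; lra.
have bb : 0 < sq x + sq y by rewrite addr_gt0// sq_gt0.
pose b := arcosh (1 + 2 * (sq x + sq y)).
have sb : sq b = sq x + sq y by rewrite sq_arcosh// ltW.
have b_ge0 : 0 <= b by rewrite arcosh_ge0//; lra.
have b_gt0 : 0 < b.
  by rewrite lt_neqAle b_ge0 andbT; apply: contra_ltN bb => /eqP b_0; rewrite -sb -b_0 sq0.
have xb : x < b by rewrite -lt_sq ?nnegrE ?ltW// sb ltrDl sq_gt0.
have yb : y < b by rewrite -lt_sq ?nnegrE ?ltW// sb ltrDr sq_gt0.
have K0 : 0 < heron (sq b) (sq x) (sq y).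
  rewrite (heron_pythagoras sb); have := sq_gt0 x0; have := sq_gt0 y0.
  by move: (sq x) (sq y) => X Y Y0 X0; rewrite !mulr_gt0.
have [v [v1 v2 /(_ sb) v3]] := cyclic_exists b_gt0 x0 y0 K0.
case: (none b); split.
  by move=> t; rewrite !inE => /orP[] /eqP->.
by exists 3%N, v.
Qed.
End Polygons.

(** * Comparison of areas of nonobtuse triangles *)

Section AreaBounds.
Context {R : realType}.
Implicit Types (a b c d x y : R) (A B C D : R).

Lemma cos2_half_area_perm A B C A' B' C' :
  perm_eq [:: A; B; C] [:: A'; B'; C'] ->
  cos2_half_area A B C = cos2_half_area A' B' C'.
Proof.
move=> st.
have E (a b c : R) : cos2_half_area a b c = (2 + \sum_(x <- [:: a; b; c]) x) ^+ 2 /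
    (4 * \prod_(x <- [:: a; b; c]) (1 + x)).
  by rewrite /cos2_half_area !big_cons !big_nil addr0 mulr1 !addrA !mulrA.
by rewrite !E (perm_big _ st) /= [X in _ / (_ * X)](perm_big _ st).
Qed.

Lemma heron_perm A B C A' B' C' :
  perm_eq [:: A; B; C] [:: A'; B'; C'] -> heron A B C = heron A' B' C'.
Proof.
move=> st.
have E (a b c : R) : heron a b c = (\sum_(x <- [:: a; b; c]) x) ^+ 2 -
    2 * \sum_(x <- [:: a; b; c]) x ^+ 2.
  by rewrite /heron !big_cons !big_nil; ring.
by rewrite !E (perm_big _ st) /= [X in _ * X](perm_big _ st).
Qed.

(** The area formula is symmetric in the sides. This is used because the labels at a vertex come in
    the order of an enumeration. *)
Lemma D0_perm s a b c : perm_eq s [:: a; b; c] -> 0 < a -> 0 < b -> 0 < c ->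
  0 < heron (sq a) (sq b) (sq c) -> D0 s = D0 [:: a; b; c].
Proof.
move=> st a0 b0 c0 K0.
have := perm_size st; case: s st => [|x [|y [|z []]]]// st _.
have pos t : t \in [:: x; y; z] -> 0 < t.
  by rewrite (perm_mem st) !inE => /or3P[] /eqP->.
have x0 : 0 < x by apply: pos; rewrite !inE eqxx.
have y0 : 0 < y by apply: pos; rewrite !inE eqxx orbT.
have z0 : 0 < z by apply: pos; rewrite !inE eqxx !orbT.
have sst : perm_eq [:: sq x; sq y; sq z] [:: sq a; sq b; sq c] := perm_map sq st.
have K0' : 0 < heron (sq x) (sq y) (sq z) by rewrite (heron_perm sst).
apply: (is_area_uniq (is_area_D0 x0 y0 z0 K0') (is_area_D0 a0 b0 c0 K0)).
exact: (cos2_half_area_perm sst).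
Qed.

Lemma heron_gt0 A B C : 0 < B -> 0 < C -> B <= A -> C <= A -> A <= B + C ->
  0 < heron A B C.
Proof.
move=> B0 C0 BA CA ABC.
have -> : heron A B C = 4 * (B * C) - (B + C - A) * (B + C - A) by rewrite /heron; ring.
have : 0 < B * C by rewrite mulr_gt0.
have : (B + C - A) * (B + C - A) <= B * C by apply: ler_pM; lra.
lra.
Qed.

(** Up to a positive factor the difference is [(C - C') * ((1 + A + B) ^+ 2 - (1 + C) * (1 + C'))],
    and both [C] and [C'] are at most [A + B]. *)
Lemma cos2_half_area_lt A B C C' : 0 <= A -> 0 <= B -> 0 <= C' -> C' < C -> C <= A + B ->
  cos2_half_area A B C < cos2_half_area A B C'.
Proof.
move=> A0 B0 C'0 CC CAB; rewrite /cos2_half_area -subr_gt0.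
have -> : (2 + A + B + C') ^+ 2 / (4 * (1 + A) * (1 + B) * (1 + C')) -
  (2 + A + B + C) ^+ 2 / (4 * (1 + A) * (1 + B) * (1 + C)) =
  (C - C') * ((1 + A + B) ^+ 2 - (1 + C) * (1 + C')) /
  (4 * (1 + A) * (1 + B) * (1 + C) * (1 + C')).
  by field; rewrite !gt_eqF//; lra.
have H : (1 + C) * (1 + C') < (1 + A + B) * (1 + A + B).
  apply: (@le_lt_trans _ _ ((1 + A + B) * (1 + C'))).
    by apply: ler_wpM2r; lra.
  by rewrite ltr_pM2l; lra.
apply: divr_gt0; first by apply: mulr_gt0; rewrite subr_gt0.
by rewrite !mulr_gt0//; lra.
Qed.

Lemma cos2_half_area_le A B C C' : 0 <= A -> 0 <= B -> 0 <= C' -> C' <= C -> C <= A + B ->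
  cos2_half_area A B C <= cos2_half_area A B C'.
Proof.
move=> A0 B0 C'0; rewrite le_eqVlt => /predU1P[->//|CC CAB].
exact/ltW/cos2_half_area_lt.
Qed.

(** Since [B / (1 + B)] is [tanh (b / 2) ^+ 2], this says that the sine of half the area is
    [tanh (b / 2) * tanh (c / 2)]. *)
Lemma cos2_half_area_semicyclic B C : 0 <= B -> 0 <= C ->
  cos2_half_area (B + C) B C = 1 - (B / (1 + B)) * (C / (1 + C)).
Proof.
by move=> B0 C0; rewrite /cos2_half_area; field; rewrite !gt_eqF//; lra.
Qed.

Lemma semicyclic_le B C D : 0 < D -> D <= B -> D <= C ->
  cos2_half_area (B + C) B C <= cos2_half_area (D + D) D D /\
  (D < B -> cos2_half_area (B + C) B C < cos2_half_area (D + D) D D).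
Proof.
move=> D0 DB DC; rewrite !cos2_half_area_semicyclic; try lra.
have E X : D <= X -> X / (1 + X) - D / (1 + D) = (X - D) / ((1 + X) * (1 + D)).
  by move=> DX; field; rewrite !gt_eqF//; lra.
have pos : 0 < D / (1 + D) by rewrite divr_gt0//; lra.
have le X : D <= X -> D / (1 + D) <= X / (1 + X).
  by move=> DX; rewrite -subr_ge0 E// divr_ge0 ?mulr_ge0//; lra.
have lt X : D < X -> D / (1 + D) < X / (1 + X).
  by move=> DX; rewrite -subr_gt0 E ?(ltW DX)// divr_gt0 ?mulr_gt0//; lra.
have := le _ DB; have := le _ DC; have := lt B.
move: (B / _) (C / _) (D / _) pos => u v w w0 lt' wv wu.
split=> [|/lt' wu']; nra.
Qed.

(* First [C] and then [B] is decreased, down to [D] at most, until the triangle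
   is semicyclic; at each step the area decreases. *)
Lemma nonobtuse_le A B C D : 0 < D -> D <= B -> D <= C -> D + D <= A ->
    B <= A -> C <= A -> A <= B + C ->
  cos2_half_area A B C <= cos2_half_area (D + D) D D /\
  (D < B -> cos2_half_area A B C < cos2_half_area (D + D) D D).
Proof.
move=> D0 DB DC DA BA CA ABC.
have [AB|AB] := leP D (A - B).
  have H : cos2_half_area A B C <= cos2_half_area A B (A - B).
    by apply: cos2_half_area_le; lra.
  have [le lt] := semicyclic_le D0 DB AB.
  rewrite addrC subrK in le lt.
  by split=> [|/lt]; [exact: le_trans le|exact: le_lt_trans].
(* Now [A - B < D]: the side [C] stops at [D], and [B] is lowered to [A - D], which is less than
   [B], so this step is strict. *)
suff lt : cos2_half_area A B C < cos2_half_area (D + D) D D by split=> //; exact: ltW.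
have sw (X Y Z : R) : cos2_half_area X Y Z = cos2_half_area X Z Y.
  by apply: cos2_half_area_perm; rewrite perm_cons; apply/permPl/(perm_catC [:: _] [:: _]).
have H1 : cos2_half_area A B C <= cos2_half_area A B D by apply: cos2_half_area_le; lra.
have H2 : cos2_half_area A B D < cos2_half_area A (A - D) D.
  by rewrite sw [ltRHS]sw; apply: cos2_half_area_lt; lra.
have DAD : D <= A - D by lra.
have [le _] := semicyclic_le D0 DAD (lexx D).
rewrite subrK in le.
exact: (le_lt_trans H1 (lt_le_trans H2 le)).
Qed.

Lemma is_area_Am d : 0 < d -> is_area (sq d + sq d) (sq d) (sq d) (Am d).
Proof.
move=> d0; have [db _ sb] := b0P d0 d0.
have s0 := sq_gt0 d0.
have bd0 : 0 < b0 [:: d; d] by exact: lt_trans db.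
have p : perm_eq [:: sq d; sq d; sq d + sq d] [:: sq d + sq d; sq d; sq d].
  by apply/permPl/(perm_catC [:: _; _] [:: _]).
have K0 : 0 < heron (sq d) (sq d) (sq (b0 [:: d; d])).
  by rewrite sb (heron_perm p) heron_gt0//; lra.
have [x0 xpi xE] := is_area_D0 d0 d0 bd0 K0.
by split=> //; rewrite xE sb; exact: cos2_half_area_perm.
Qed.

Lemma nonobtuse_area a b c d : 0 < d -> d <= b -> d <= c -> b <= a -> c <= a ->
    sq d + sq d <= sq a <= sq b + sq c ->
  Am d <= D0 [:: a; b; c] /\ (d < b -> Am d < D0 [:: a; b; c]).
Proof.
move=> d0 db dc ba ca /andP[da abc].
have b0 : 0 < b by lra.
have c0 : 0 < c by lra.
have a0 : 0 < a by lra.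
have le_sq x y : 0 < x -> x <= y -> sq x <= sq y by move=> x0; apply: le_sq; exact: ltW.
have lt_sq' x y : 0 < x -> x < y -> sq x < sq y.
  by move=> x0 xy; rewrite lt_sq// nnegrE; lra.
have K0 : 0 < heron (sq a) (sq b) (sq c).
  by apply: heron_gt0; rewrite ?sq_gt0 ?le_sq.
have [le lt] := nonobtuse_le (sq_gt0 d0) (le_sq _ _ d0 db) (le_sq _ _ d0 dc) da
  (le_sq _ _ b0 ba) (le_sq _ _ c0 ca) abc.
have A1 := is_area_D0 a0 b0 c0 K0; have A2 := is_area_Am d0.
split; first by rewrite (is_area_le A2 A1).
by move=> dltb; rewrite (is_area_lt A2 A1) lt// lt_sq'.
Qed.

End AreaBounds.

(** * Rooted trees *)

Section TreeStructure.
Variables (n : nat) (T : frontier_graph n).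
Hypothesis treeT : is_tree T.
Notation V := 'I_(nvertices T).
Notation root := (tree_root T).
Implicit Types u v w : V.

Let arc v : seq V := sval (cid (treeT.2 v root)).

Let arcP v : tree_arc v (arc v) root.
Proof. exact: (svalP (cid (treeT.2 v root))).1. Qed.

Let arc_uniq v s : tree_arc v s root -> s = arc v.
Proof. by move=> /((svalP (cid (treeT.2 v root))).2 s) <-. Qed.

Definition depth v : nat := size (arc v).
Definition parent v : V := head v (arc v).
Definition parent_edge v : edge T := inl [set v; parent v]%SET.

Lemma adjC u v : adj u v = adj v u.
Proof. by rewrite /adj finset.setUC. Qed.

Lemma adj_neq u v : adj u v -> u != v.
Proof. by move=> /(treeT.1); apply: contra_eq_neq => ->; rewrite finset.setUid cards1. Qed.

Let arc_parent v : v != root ->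
  arc v = parent v :: arc (parent v) /\ adj v (parent v).
Proof.
move=> vr; have := arcP v; rewrite /parent.
case E : (arc v) => [|u s] /and3P[/= p U L].
  by rewrite (eqP L) eqxx in vr.
move: p => /andP[vu p]; split=> //; congr (_ :: _).
apply: arc_uniq; rewrite /tree_arc p L andbT /=.
by case/andP: U.
Qed.

Lemma adj_parent v : v != root -> adj v (parent v).
Proof. by case/arc_parent. Qed.

Lemma parent_neq v : v != root -> parent v != v.
Proof. by move=> /adj_parent/adj_neq; rewrite eq_sym. Qed.

Lemma depth_parent v : v != root -> depth v = (depth (parent v)).+1.
Proof. by case/arc_parent; rewrite {1}/depth => ->. Qed.

Lemma depth_lt v : (depth v < nvertices T)%N.
Proof.
have /and3P[_ U _] := arcP v.
have := card_uniqP U; rewrite /= -/(depth v) => <-.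
by rewrite -[X in (_ <= X)%N]card_ord max_card.
Qed.

Lemma initial_edgeP v e : initial_edge v e <-> v != root /\ e = parent_edge v.
Proof.
split=> [[u [s [us ->]]]|[vr ->]].
  have vr : v != root.
    have /and3P[_ /andP[vs _] /eqP <-] := us.
    by apply: contraNneq vs => {1}->; rewrite /= mem_last.
  split=> //; rewrite /parent_edge /parent.
  by rewrite -(arc_uniq us).
have [E _] := arc_parent vr.
by exists (parent v), (arc (parent v)); rewrite -E; split.
Qed.

(** If [v] is not on the arc from [u] to the root, then prefixing [u] to that arc gives the arc from
    [v]. If [v] is on it, the edge to [v] followed by the tail after [v] is an arc from [u] as well,
    so uniqueness makes [v] the first vertex. *)
Lemma adjP u v : adj u v ->
  (u != root /\ parent u = v) \/ (v != root /\ parent v = u).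
Proof.
move=> uv; have uneqv := adj_neq uv.
have /and3P[p U L] := arcP u.
have [vs|vs] := boolP (v \in arc u); last first.
  right; have A : tree_arc v (u :: arc u) root.
    rewrite /tree_arc /= adjC uv p L andbT /=.
    by move: U => /= ->; rewrite inE negb_or eq_sym uneqv vs.
  have E := arc_uniq A.
  split; last by rewrite /parent -E.
  apply/eqP => vr; move: vs L uneqv; rewrite vr; case: (arc u) => [_ /= ->//|w s].
  by move=> /negP vs /eqP L _; apply: vs; rewrite -L /= mem_last.
left; have ur : u != root.
  apply/eqP => ur; move: U vs L; case: (arc u) => //= w s /andP[us _] _ /eqP L.
  by move: us; rewrite ur -L mem_last.
split=> //.
have [E _] := arc_parent ur.
move: vs p U L; case/path.splitP => s1 s2; rewrite cat_path last_cat last_rcons.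
move=> /andP[_ p2] U L.
have A : tree_arc u (v :: s2) root.
  rewrite /tree_arc /= uv p2 L andbT /=.
  move: U; rewrite /= mem_cat mem_rcons inE !negb_or cat_uniq -!andbA.
  move=> /and5P[uv' _ us2 _ /andP[/hasPn H ->]].
  rewrite uv' us2 !andbT /=.
  by apply/negP => /H /=; rewrite mem_rcons mem_head.
by rewrite /parent -(arc_uniq A).
Qed.

Lemma tree_edgeP a : a \in tree_edges T ->
  exists2 v, v != root & inl a = parent_edge v.
Proof.
move=> aT; have /eqP/cards2P[u [v [_ aE]]] := treeT.1 _ aT.
have uv : adj u v by rewrite /adj -aE.
case/adjP: uv => -[r E]; [exists u|exists v] => //; rewrite /parent_edge E aE//.
by rewrite finset.setUC.
Qed.

(** Distinct vertices with the same parent edge would be parents of each other, against the growth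
    of the depth. *)
Lemma parent_edge_inj u v : u != root -> v != root ->
  parent_edge u = parent_edge v -> u = v.
Proof.
move=> ur vr []; have du := depth_parent ur; have dv := depth_parent vr.
move=> E; apply/eqP; apply/negPn/negP => uv.
have : u \in [set v; parent v]%SET by rewrite -E set21.
have : v \in [set u; parent u]%SET by rewrite E set21.
rewrite !inE eq_sym (negbTE uv) /= => /eqP vu /eqP uv'.
by move: du dv; rewrite -vu -uv' => ->; lia.
Qed.

Lemma edges_atP v e : e \in edges_at v ->
  (exists f, e = inr f) \/
  exists2 w, w != root & e = parent_edge w /\ (w = v \/ parent w = v).
Proof.
rewrite inE; case: e => [a /andP[aT va]|f _]; last by left; exists f.
have [w wr E] := tree_edgeP aT; right; exists w => //; split=> //.
move: va; case: E => ->; rewrite !inE => /orP[] /eqP->; by [left|right].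
Qed.

Lemma parent_edge_at v : v != root -> parent_edge v \in edges_at v.
Proof. by move=> vr; rewrite inE /= set21 andbT; exact: adj_parent. Qed.

Lemma parent_edge_at_parent v : v != root -> parent_edge v \in edges_at (parent v).
Proof. by move=> vr; rewrite inE /= set22 andbT; exact: adj_parent. Qed.

Lemma card_tree_edges : #|tree_edges T| = (nvertices T).-1.
Proof.
have -> : tree_edges T = [set [set v; parent v]%SET | v in [set~ root]%SET]%SET.
  apply/setP => a; apply/idP/imsetP => [/tree_edgeP[v vr [->]]|[v vr ->]].
    by exists v; rewrite // !inE.
  by apply: adj_parent; move: vr; rewrite !inE.
rewrite card_in_imset ?cardsC1 ?card_ord// => u v; rewrite !inE => ur vr E.
by apply: parent_edge_inj => //; rewrite /parent_edge E.
Qed.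

Lemma card_edges_at v : #|edges_at v| =
  (\sum_(a in tree_edges T) (v \in a) + \sum_(f < n) (foot T f == v))%N.
Proof.
rewrite -sum1_card big_mkcond /= big_sumType /=; congr (_ + _)%N.
  rewrite [RHS]big_mkcond; apply: eq_bigr => a _; rewrite inE /=.
  by case: (a \in _) => //=; case: (v \in _).
by apply: eq_bigr => f _; rewrite inE; case: (_ == _).
Qed.

(** Count incidences of vertices and edges: [N] vertices have [3 * N] of them, the [N - 1] tree
    edges account for two each and the [n] frontier edges for one each. *)
Lemma nvertices_trivalent : (forall v, #|edges_at v| = 3%N) -> nvertices T = (n - 2)%N.
Proof.
move=> H.
have E : (\sum_(v : V) #|edges_at v| = 2 * (nvertices T).-1 + n)%N.
  rewrite (eq_bigr _ (fun v _ => card_edges_at v)).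
  rewrite big_split /= exchange_big /=; congr (_ + _)%N.
    rewrite -card_tree_edges mulnC -sum_nat_const; apply: eq_bigr => a /(treeT.1) <-.
    by rewrite -sum1_card [RHS]big_mkcond; apply: eq_bigr => v _; case: (v \in a).
  rewrite exchange_big /= -[RHS]card_ord -sum1_card; apply: eq_bigr => f _.
  rewrite (bigD1 (foot T f)) //= eqxx big1 // => v; rewrite eq_sym => /negbTE->.
  by [].
move: E; under eq_bigr do rewrite H.
rewrite sum_nat_const card_ord.
have : (0 < nvertices T)%N by apply: leq_trans (ltn_ord root).
move: (nvertices T) => m; lia.
Qed.
End TreeStructure.

(** * Labels of the edges and areas at the vertices *)

Section TreeLabels.
Context {R : realType}.
Variables (n : nat) (T : frontier_graph n).
Hypothesis treeT : is_tree T.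
Notation V := 'I_(nvertices T).
Notation root := (tree_root T).
Notation parent := (parent treeT).
Notation parent_edge := (parent_edge treeT).
Notation depth := (depth treeT).
Implicit Types (u v w : V) (b : {ffun edge T -> R}) (A : {set edge T}).

Lemma labels_rem b A e : e \in A ->
  perm_eq (labels b A) (b e :: labels b (A :\ e)%SET).
Proof.
move=> eA; rewrite /labels -map_cons; apply: perm_map.
apply: uniq_perm; first exact: enum_uniq.
  by rewrite /= mem_enum !inE eqxx enum_uniq.
by move=> x; rewrite inE !mem_enum !inE; case: eqVneq => // ->.
Qed.

Lemma size_labels b A : size (labels b A) = #|A|.
Proof. by rewrite size_map -cardE. Qed.

Lemma mem_labelsP b A t : reflect (exists2 e, e \in A & t = b e) (t \in labels b A).
Proof.
by apply: (iffP mapP) => -[e]; rewrite ?mem_enum => eA ->; exists e; rewrite ?mem_enum.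
Qed.

(** The map [F] performs one step of the recursion at every edge simultaneously. Labels settle from
    the deepest vertices upward: that of the parent edge of [v] is final after
    [nvertices T - depth v] iterations. *)
Lemma extends_to_edges_exists (bF : {ffun 'I_n -> R}) :
  exists b, extends_to_edges bF b.
Proof.
pose F b : {ffun edge T -> R} := [ffun e => match e with
  | inr f => bF f
  | inl _ => if [pick v | (v != root) && (parent_edge v == e)] is Some v
             then b0 (labels b (edges_at v :\ e)%SET) else 0
  end].
pose B k := iter k F (F [ffun=> 0]).
have Fr b f : F b (inr f) = bF f by rewrite ffunE.
have Fl b v : v != root ->
    F b (parent_edge v) = b0 (labels b (edges_at v :\ parent_edge v)%SET).
  move=> vr; rewrite ffunE /=; case: pickP => [w /andP[wr /eqP wv]|/(_ v)].
    by rewrite (parent_edge_inj wr vr wv).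
  by rewrite vr eqxx.
have Br k f : B k (inr f) = bF f by case: k => [|k]; rewrite /B ?iterS Fr.
have stable k v : v != root -> (nvertices T <= depth v + k)%N ->
    B k (parent_edge v) = B k.+1 (parent_edge v).
  elim: k v => [|k IH] v vr; first by rewrite addn0 leqNgt depth_lt.
  move=> dk; rewrite [LHS]Fl// [RHS]Fl//; congr b0; apply/eq_in_map => e.
  rewrite mem_enum 2!inE => /andP[ev /edges_atP-/(_ treeT)].
  case=> [[f ->]|[w wr [eE wv]]]; first by rewrite !Br.
  case: wv => wv; first by rewrite eE wv eqxx in ev.
  by rewrite eE IH//; move: dk; rewrite -wv (depth_parent treeT wr); lia.
exists (B (nvertices T)); split=> [f|v e vr /initial_edgeP-/(_ treeT)[_ ->]].
  exact: Br.
by rewrite stable ?leq_addl// [LHS]Fl.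
Qed.

Hypothesis degree3 : forall v, #|edges_at v| = 3%N.
Variables (d : R) (d_gt0 : 0 < d) (b : {ffun edge T -> R}).
Hypothesis bE : extends_to_edges [ffun=> d] b.

Let others v : seq R := labels b (edges_at v :\ parent_edge v)%SET.

Let label_parent_edge v : v != root -> b (parent_edge v) = b0 (others v).
Proof. by move=> vr; apply: bE.2 => //; apply/initial_edgeP. Qed.

Let label_frontier f : b (inr f) = d.
Proof. by rewrite bE.1 ffunE. Qed.

Let size_others v : v != root -> size (others v) = 2%N.
Proof.
move=> vr; rewrite size_labels; have := cardsD1 (parent_edge v) (edges_at v).
by rewrite degree3 parent_edge_at// add1n => -[].
Qed.

Let others_ge v : v != root ->
  (forall w, w != root -> parent w = v -> d < b (parent_edge w)) ->
  forall t, t \in others v -> d <= t.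
Proof.
move=> vr IH t /mem_labelsP[e]; rewrite 2!inE => /andP[ev /edges_atP-/(_ treeT)].
case=> [[f ->]|[w wr [eE wv]]] ->; first by rewrite label_frontier.
case: wv => wv; first by rewrite eE wv eqxx in ev.
by rewrite eE ltW// IH.
Qed.

(** Induction from the deepest vertices toward the root: the two other labels at [v] are at least
    [d], and [b0] exceeds both. *)
Let label_gt v : v != root -> d < b (parent_edge v).
Proof.
have [k] := ubnP (nvertices T - depth v).
elim: k v => // k IH v dk vr.
have ge : forall t, t \in others v -> d <= t.
  apply: others_ge => // w wr wv; apply: IH => //.
  have := depth_lt treeT w; move: dk; rewrite (depth_parent treeT wr) wv; lia.
rewrite label_parent_edge//; move: ge (size_others vr).
case: (others v) => [|x [|y []]]// ge _.
have dx : d <= x by apply: ge; rewrite !inE eqxx.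
have dy : d <= y by apply: ge; rewrite !inE eqxx orbT.
have [xb _ _] := b0P (lt_le_trans d_gt0 dx) (lt_le_trans d_gt0 dy).
exact: le_lt_trans xb.
Qed.

Lemma label_ge v e : e \in edges_at v -> d <= b e.
Proof.
move=> /edges_atP-/(_ treeT)[[f ->]|[w wr [-> _]]]; first by rewrite label_frontier.
exact/ltW/label_gt.
Qed.

Lemma vertex_label v : v != root -> exists x y,
  [/\ d <= x, d <= y, others v = [:: x; y] &
   perm_eq (labels b (edges_at v)) [:: b0 [:: x; y]; x; y]].
Proof.
move=> vr.
have ge t : t \in others v -> d <= t.
  by move=> /mem_labelsP[e]; rewrite 2!inE => /andP[_ /label_ge ?] ->.
have := labels_rem b (parent_edge_at treeT vr).
rewrite label_parent_edge// -/(others v).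
move: ge (size_others vr); case: (others v) => [|x [|y []]]// ge _ p.
by exists x, y; split=> //; apply: ge; rewrite !inE eqxx ?orbT.
Qed.

Lemma sq_label_ge v : v != root -> sq d + sq d <= sq (b (parent_edge v)).
Proof.
move=> vr; rewrite label_parent_edge//; have [x [y [dx dy -> _]]] := vertex_label vr.
have [_ _ ->] := b0P (lt_le_trans d_gt0 dx) (lt_le_trans d_gt0 dy).
have le_sq t : d <= t -> sq d <= sq t by move=> dt; apply: le_sq => //; exact: ltW.
by apply: lerD; exact: le_sq.
Qed.

Lemma D0_semicyclic x y : d <= x -> d <= y ->
  [/\ Am d <= D0 [:: b0 [:: x; y]; x; y],
      d < x \/ d < y -> Am d < D0 [:: b0 [:: x; y]; x; y] &
      forall s, perm_eq s [:: b0 [:: x; y]; x; y] -> D0 s = D0 [:: b0 [:: x; y]; x; y]].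
Proof.
move=> dx dy; have x0 := lt_le_trans d_gt0 dx; have y0 := lt_le_trans d_gt0 dy.
have [xb yb sb] := b0P x0 y0.
have le_sq t : d <= t -> sq d <= sq t by move=> dt; apply: le_sq => //; exact: ltW.
set a := b0 _ in xb yb sb *.
have a0 : 0 < a by lra.
have sx0 := sq_gt0 x0; have sy0 := sq_gt0 y0.
have K0 : 0 < heron (sq a) (sq x) (sq y) by rewrite heron_gt0// sb; lra.
have DA : sq d + sq d <= sq a <= sq x + sq y.
  by rewrite sb lexx andbT lerD// le_sq.
have DA' : sq d + sq d <= sq a <= sq y + sq x by rewrite [sq y + _]addrC.
have perm s : perm_eq s [:: a; x; y] -> D0 s = D0 [:: a; x; y].
  by move=> p; exact: D0_perm.
have [le lt] := nonobtuse_area d_gt0 dx dy (ltW xb) (ltW yb) DA.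
have [_ lt'] := nonobtuse_area d_gt0 dy dx (ltW yb) (ltW xb) DA'.
split=> // -[/lt//|/lt'].
by rewrite perm// perm_cons; apply/permPl/(perm_catC [:: _] [:: _]).
Qed.

Lemma vertex_area_ge v : v != root -> Am d <= D0 (labels b (edges_at v)).
Proof.
move=> vr; have [x [y [dx dy _ p]]] := vertex_label vr.
by have [le _ ->] := D0_semicyclic dx dy.
Qed.

(** The parent edge of the child [w] is one of the two shorter sides at [v], and its label is
    greater than [d]. *)
Lemma vertex_area_gt v w : v != root -> w != root -> parent w = v ->
  Am d < D0 (labels b (edges_at v)).
Proof.
move=> vr wr wv; have [x [y [dx dy xy p]]] := vertex_label vr.
have [_ lt ->//] := D0_semicyclic dx dy; apply: lt.
have : b (parent_edge w) \in others v.
  apply/mem_labelsP; exists (parent_edge w) => //.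
  rewrite 2!inE -{2}wv parent_edge_at_parent// andbT.
  apply/eqP => /(parent_edge_inj wr vr) wv'.
  by move: (parent_neq treeT wr); rewrite wv wv' eqxx.
by have := label_gt wr; rewrite xy !inE => ? /orP[] /eqP <-; [left|right].
Qed.

Lemma root_label : exists x y z,
  [/\ sort >=%R (labels b (edges_at root)) = [:: x; y; z],
      perm_eq [:: x; y; z] (labels b (edges_at root)), z <= y <= x & d <= z].
Proof.
have p : perm_eq (sort >=%R (labels b (edges_at root))) (labels b (edges_at root)).
  by apply/permPl/perm_sort.
have S := sort_sorted (fun x y : R => ge_total x y) (labels b (edges_at root)).
have := size_sort >=%R (labels b (edges_at root)); rewrite size_labels degree3.
move: p S; case: (sort _ _) => [|x [|y [|z []]]]//= p /and3P[yx zy _] _.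
exists x, y, z; split; rewrite ?yx ?zy//.
have : z \in labels b (edges_at root) by rewrite -(perm_mem p) !inE eqxx !orbT.
by move=> /mem_labelsP[e /label_ge ? ->].
Qed.

(* The truncation at the root makes the triangle nonobtuse. *)
Lemma root_area_ge w : w != root -> parent w = root ->
  Am d <= root_area b /\
  (forall w', w' != root -> parent w' = root -> w' != w -> Am d < root_area b).
Proof.
move=> wr wroot; rewrite /root_area.
have [x [y [z [-> p /andP[zy yx] dz]]]] := root_label.
rewrite /=.
have z0 := lt_le_trans d_gt0 dz.
have dy := le_trans dz zy; have y0 := lt_le_trans d_gt0 dy.
have [yb zb sb] := b0P y0 z0.
have le_sq (s t : R) : 0 < s -> s <= t -> sq s <= sq t by move=> s0; apply: le_sq; exact: ltW.
(* The parent edge of the child [w] is among the labels at the root, so the bound for it passes to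
   the largest label [x]. *)
have dw : sq d + sq d <= sq x.
  apply: le_trans (sq_label_ge wr) _; apply: le_sq.
    by apply: lt_trans (label_gt wr).
  have : b (parent_edge w) \in [:: x; y; z].
    rewrite (perm_mem p); apply/mem_labelsP; exists (parent_edge w) => //.
    by rewrite -wroot parent_edge_at_parent.
  by rewrite !inE => /or3P[] /eqP->; lra.
set a := Num.min x _.
have ya : y <= a by rewrite /a le_min yx ltW.
have za : z <= a by rewrite (le_trans zy).
have DA : sq d + sq d <= sq a <= sq y + sq z.
  rewrite /a; case: (leP x (b0 [:: y; z])) => [xb|/ltW xb].
    by rewrite dw -sb le_sq//; lra.
  by rewrite sb lexx andbT lerD// le_sq.
have [le lt] := nonobtuse_area d_gt0 dy dz ya za DA.
split=> // w' w'r w'root ww'; apply: lt.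
rewrite ltNge; apply/negP => yd.
have zd := le_trans zy yd.
(* Two children contribute two labels above [d], whereas [y] and [z] being at most [d] would leave
   only [x]. *)
have : (2 <= count (fun t => d < t)%R [:: x; y; z])%N.
  have wA : parent_edge w \in edges_at root by rewrite -wroot parent_edge_at_parent.
  have w'A : parent_edge w' \in (edges_at root :\ parent_edge w)%SET.
    rewrite 2!inE -{1}w'root parent_edge_at_parent// andbT.
    by apply: contra_neq ww'; exact: parent_edge_inj.
  rewrite (seq.permP p) (seq.permP (labels_rem b wA)) /= (seq.permP (labels_rem b w'A)) /=.
  by rewrite !label_gt.
by rewrite /= !ltNge yd zd; case: (_ <= _).
Qed.
End TreeLabels.

(** * A trivalent tree for every number of frontier edges from three on *)

Lemma set2_inj (U : finType) (a b c d : U) : [set a; b]%SET = [set c; d]%SET ->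
  (a = c /\ b = d) \/ (a = d /\ b = c).
Proof.
move=> E.
have : a \in [set c; d]%SET by rewrite -E set21.
have : b \in [set c; d]%SET by rewrite -E set22.
have : c \in [set a; b]%SET by rewrite E set21.
have : d \in [set a; b]%SET by rewrite E set22.
rewrite !inE => H1 H2 /orP[/eqP bc|/eqP bd] /orP[/eqP ac|/eqP ad]; subst; auto.
- by move: H1; rewrite orbb => /eqP->; left.
- by move: H2; rewrite orbb => /eqP->; left.
Qed.

Section Caterpillar.
Variable m : nat.
Notation V := 'I_m.+1.
Implicit Types x y z : V.

Let cat_edges : {set {set V}} :=
  [set a | [exists x : V, exists y : V, (y == x.+1 :> nat) && (a == [set x; y]%SET)]]%SET.

(* Frontier edge [f] is attached to the path [0, ..., m] at [f - 1], clipped to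
   this range, so that each end of the path carries an additional one. *)
Let cat_foot : {ffun 'I_m.+3 -> V} := [ffun f : 'I_m.+3 => inord (minn f.-1 m)].

Definition caterpillar : frontier_graph m.+3 := FrontierGraph cat_edges ord0 cat_foot.

Notation catadj := (@adj m.+3 caterpillar).

Let adjE x y : catadj x y = (y == x.+1 :> nat) || (x == y.+1 :> nat).
Proof.
rewrite /adj inE; apply/existsP/orP => [[u /existsP[v /andP[uv /eqP/set2_inj]]]|].
  by case=> -[-> ->]; [left|right].
case=> xy; [exists x; apply/existsP; exists y|exists y; apply/existsP; exists x];
  by rewrite xy ?eqxx// finset.setUC eqxx.
Qed.

(** Consecutive vertices differ by one, so a walk cannot cross [x] without visiting it. *)
Let path_lt x z s : (z < x)%N -> path catadj z s -> x \notin s -> (last z s < x)%N.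
Proof.
elim: s z => //= t s IH z zx /andP[zt p]; rewrite inE negb_or => /andP[xt xs].
apply: IH => //; move: zt xt; rewrite adjE -val_eqE /=; lia.
Qed.

Let path_gt x z s : (x < z)%N -> path catadj z s -> x \notin s -> (x < last z s)%N.
Proof.
elim: s z => //= t s IH z zx /andP[zt p]; rewrite inE negb_or => /andP[xt xs].
apply: IH => //; move: zt xt; rewrite adjE -val_eqE /=; lia.
Qed.

(** A first step away from [y] would force the arc back through [x]. The direction of each step is
    thus determined, whence uniqueness of arcs. *)
Let arc_step x z s y : @tree_arc m.+3 caterpillar x (z :: s) y ->
  (z : nat) = (if x < y then x.+1 else x.-1)%N.
Proof.
move=> /and3P[/= /andP[xz p] /andP[+ _] /eqP L].
rewrite inE negb_or => /andP[_ xs].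
move: xz; rewrite adjE => /orP[] /eqP E.
  by have := path_gt _ p xs; rewrite L => ->; [rewrite E|rewrite E].
have := path_lt _ p xs; rewrite L E ltnSn => /(_ isT) ?.
by rewrite ltnNge ltnW.
Qed.

Let arc_uniq x s t y : @tree_arc m.+3 caterpillar x s y ->
  @tree_arc m.+3 caterpillar x t y -> s = t.
Proof.
have nil u w r : @tree_arc m.+3 caterpillar u (w :: r) u -> False.
  by move=> /and3P[_ /andP[+ _] /eqP /= E]; rewrite -{1}E mem_last.
elim: s t x => [|z s IH] [|w t] x //.
- by move=> /and3P[_ _ /eqP/= <-] /nil.
- by move=> A /and3P[_ _ /eqP/= E]; move: A; rewrite -E => /nil.
- move=> A B; have := arc_step A; rewrite -(arc_step B) => /val_inj zw; subst w.
  congr (_ :: _); apply: (IH _ z).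
    by case/and3P: A => /= /andP[_ p] /andP[_ U] L; apply/and3P.
  by case/and3P: B => /= /andP[_ p] /andP[_ U] L; apply/and3P.
Qed.

Let arc_exists x y : exists s, @tree_arc m.+3 caterpillar x s y.
Proof.
have sym : connect_sym catadj.
  by apply: sym_connect_sym => u v; rewrite !adjE orbC.
have to0 u : connect catadj u ord0.
  case: u; elim=> [|k IH] ku.
    by rewrite (_ : Ordinal ku = ord0) ?connect0//; exact: val_inj.
  apply: connect_trans (IH (ltnW ku)); apply: connect1.
  by rewrite adjE /= eqxx orbT.
have : connect catadj x y by apply: connect_trans (to0 x) _; rewrite sym.
move=> /connectP[s p ->]; case/shortenP: p => t p U _.
by exists t; apply/and3P; split=> //=.
Qed.

Lemma is_tree_caterpillar : is_tree caterpillar.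
Proof.
split=> [a|x y].
  rewrite inE => /existsP[x /existsP[y /andP[xy /eqP->]]].
  by rewrite cards2 -val_eqE /= (eqP xy) ltn_eqF.
have [s A] := arc_exists x y; exists s; split=> // t; exact: arc_uniq.
Qed.

Let degree (v : V) : #|[set e : ({set V} + 'I_m.+3)%type | match e with
    | inl a => (a \in cat_edges) && (v \in a)
    | inr f => cat_foot f == v end]%SET| = 3%N.
Proof.
(* At each vertex [v] there are the edges to its left and right neighbours and the frontier edge
   [v + 1]; at the ends of the path the frontier edges [0] and [m + 2] stand in for the missing
   neighbours. *)
pose l : ({set V} + 'I_m.+3)%type :=
  if v == ord0 then inr ord0 else inl [set inord v.-1; v]%SET.
pose r : ({set V} + 'I_m.+3)%type :=
  if v == ord_max then inr ord_max else inl [set v; inord v.+1]%SET.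
pose c : ({set V} + 'I_m.+3)%type := inr (inord v.+1).
have vm : (v < m.+1)%N := ltn_ord v.
have -> : [set e : ({set V} + 'I_m.+3)%type | match e with
    | inl a => (a \in cat_edges) && (v \in a)
    | inr f => cat_foot f == v end]%SET = [set l; c; r]%SET.
  apply/setP => -[a|f]; rewrite !inE /=.
    rewrite /l /r /c; apply/andP/idP.
      move=> [/existsP[x /existsP[y /andP[/eqP xy /eqP->]]]]; rewrite !inE => /orP[] /eqP E.
        apply/orP; right; rewrite E ifF; last first.
          by apply/eqP => /(congr1 val) /=; have := ltn_ord y; lia.
        apply/eqP; congr (inl [set _; _]%SET); apply: val_inj.
        by rewrite /= inordK// -xy.
      apply/orP; left; apply/orP; left; rewrite E ifF; last first.
        by apply/eqP => /(congr1 val) /=; lia.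
      apply/eqP; congr (inl [set _; _]%SET); apply: val_inj.
      by rewrite /= xy /= inordK// ltn_ord.
    case: (eqVneq v ord0) => [v0|v0]; case: (eqVneq v ord_max) => [vmax|vmax];
      rewrite ?orbF //=.
    - move=> /eqP[->]; split; last by rewrite set21.
      apply/existsP; exists v; apply/existsP; exists (inord v.+1).
      rewrite eqxx andbT inordK//; move: vmax; rewrite -val_eqE /=; lia.
    - move=> /eqP[->]; split; last by rewrite set22.
      apply/existsP; exists (inord v.-1); apply/existsP; exists v.
      rewrite eqxx andbT inordK; move: v0; rewrite -val_eqE /=; lia.
    - move=> /orP[] /eqP[->]; split; rewrite ?set21 ?set22//.
        apply/existsP; exists (inord v.-1); apply/existsP; exists v.
        rewrite eqxx andbT inordK; move: v0; rewrite -val_eqE /=; lia.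
      apply/existsP; exists v; apply/existsP; exists (inord v.+1).
      rewrite eqxx andbT inordK//; move: vmax; rewrite -val_eqE /=; lia.
  have fm := ltn_ord f.
  have inrE (g h : 'I_m.+3) : (inr g == inr h :> ({set V} + 'I_m.+3)%type) = (g == h) by [].
  have footE : (cat_foot f == v) = (minn f.-1 m == v :> nat).
    by rewrite ffunE -(inj_eq val_inj) /= inordK// ltnS geq_minr.
  have cE : (f == inord v.+1) = (f == v.+1 :> nat).
    by rewrite -(inj_eq val_inj) /= inordK//; lia.
  rewrite footE /l /r /c inrE cE.
  have z0 (w : V) : (w == ord0) = (w == 0%N :> nat) by [].
  have zm (w : V) : (w == ord_max) = (w == m :> nat) by [].
  have f0 : (f == ord0) = (f == 0%N :> nat) by [].
  have f2 : (f == ord_max) = (f == m.+2 :> nat) by [].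
  rewrite z0 zm.
  case: (eqVneq (v : nat) 0) => v0; case: (eqVneq (v : nat) m) => vE;
    rewrite ?inrE ?orbF ?f0 ?f2 /=; lia.
have cE : (inord v.+1 : 'I_m.+3) = v.+1 :> nat by rewrite inordK//; lia.
have lc : l != c.
  rewrite /l /c; case: ifP => // _; apply/eqP => -[] /(congr1 val); rewrite /= cE; lia.
have rl : r != l.
  rewrite /l /r; case: ifP => [/eqP vE|vE]; case: ifP => [/eqP v0|v0] //.
  have v0' : (v : nat) != 0%N by exact: (negbT v0).
  have vE' : (v : nat) != m by exact: (negbT vE).
  have H1 : (inord v.+1 : V) = v.+1 :> nat by rewrite inordK//; lia.
  have H2 : (inord v.-1 : V) = v.-1 :> nat by rewrite inordK//; lia.
  apply/eqP => -[] /set2_inj[] [] =>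
    [/(congr1 (@nat_of_ord m.+1)) + _|_ /(congr1 (@nat_of_ord m.+1))] /=.
    by rewrite H2; lia.
  by rewrite H1 H2; lia.
have rc : r != c.
  rewrite /r /c; case: ifP => // [/eqP vE]; apply/eqP => -[] /(congr1 val).
  by rewrite /= cE vE /=; lia.
by rewrite finset.setUC cardsU1 cards2 lc !inE negb_or rl rc.
Qed.

Lemma trivalent_caterpillar : trivalent_tree caterpillar.
Proof. by split; [exact: is_tree_caterpillar|exact: degree]. Qed.
End Caterpillar.

(** * Bounds on [BT] *)

Section Bounds.
Context {R : realType}.
Variables (d : R) (d_gt0 : 0 < d).

Section Tree.
Variables (n : nat) (T : frontier_graph n).
Hypothesis triT : trivalent_tree T.
Notation V := 'I_(nvertices T).
Notation root := (tree_root T).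
Let treeT : is_tree T := triT.1.
Let degree3 : forall v : V, #|edges_at v| = 3%N := triT.2.
Notation parent := (parent treeT).
Notation parent_edge := (parent_edge treeT).
Implicit Types (u v w : V).

Lemma BTE : exists2 b, extends_to_edges [ffun=> d] b &
  BT T [ffun=> d] = root_area b + \sum_(v | v != root) D0 (labels b (edges_at v)).
Proof.
rewrite /BT; case: xgetP => [x _ [b [bE ->]]|none]; first by exists b.
have [b bE] := extends_to_edges_exists treeT [ffun=> d].
by case: (none (root_area b + \sum_(v | v != root) D0 (labels b (edges_at v)))); exists b.
Qed.

(** A vertex of least depth among those other than the root must have the root as parent. *)
Lemma root_child : (1 < nvertices T)%N -> exists2 w, w != root & parent w = root.
Proof.
move=> N1; have /card_gt0P[v0] : (0 < #|[set~ root]%SET|)%N by rewrite cardsC1 card_ord; lia.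
rewrite !inE => v0r.
have [w wr wmin] := @arg_minnP _ v0 (fun v => v != root) (depth treeT) v0r; exists w => //.
apply/eqP/negPn/negP => /wmin.
by rewrite [X in (X <= _)%N](depth_parent treeT wr) ltnn.
Qed.

Lemma sumr_const_nonroot (x : R) : \sum_(v | v != root) x = x *+ (nvertices T).-1.
Proof. by rewrite sumr_const cardC1 card_ord. Qed.

Lemma BT_ge : (1 < nvertices T)%N ->
  (nvertices T)%:R * Am d <= BT T [ffun=> d] /\
  ((2 < nvertices T)%N -> (nvertices T)%:R * Am d < BT T [ffun=> d]).
Proof.
move=> N1; have [b bE ->] := BTE.
have [w wr wroot] := root_child N1.
have [le lt] := root_area_ge degree3 d_gt0 bE wr wroot.
have vge v := @vertex_area_ge _ _ _ treeT degree3 d d_gt0 b bE v.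
have -> : (nvertices T)%:R * Am d = Am d + \sum_(v | v != root) Am d.
  by rewrite sumr_const_nonroot -mulrS prednK ?mulr_natl//; lia.
have sle : \sum_(v | v != root) Am d <= \sum_(v | v != root) D0 (labels b (edges_at v)).
  by apply: ler_sum => v; exact: vge.
split; first exact: lerD.
move=> N2.
(* If some [u] has a parent other than the root, the term of that parent in the sum is strictly
   larger. Otherwise all vertices but the root are its children, there are at least two, and the
   root term is strictly larger. *)
have [/existsP[u /andP[ur pur]]|] := boolP [exists u, (u != root) && (parent u != root)].
  apply: ler_ltD => //.
  rewrite (bigD1 (parent u))//= [ltRHS](bigD1 (parent u))//=.
  apply: ltr_leD; last by apply: ler_sum => v /andP[vr _]; exact: vge.
  exact: (vertex_area_gt degree3 d_gt0 bE pur ur).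
rewrite negb_exists => /forallP allroot.
have proot u : u != root -> parent u = root.
  by move=> ur; have := allroot u; rewrite ur /= negbK => /eqP.
have /card_gt0P[w'] : (0 < #|[set~ root]%SET :\ w|)%N.
  have := cardsD1 w [set~ root]%SET; rewrite cardsC1 card_ord !inE wr; lia.
rewrite !inE => /andP[w'w w'r].
by apply: ltr_leD => //; exact: (lt w' w'r (proot w' w'r) w'w).
Qed.

Lemma BT3 : nvertices T = 1%N -> BT T [ffun=> d] = D0 [:: d; d; d].
Proof.
move=> N1; have [b bE ->] := BTE.
have uniqV v : v = root.
  by apply: val_inj; case: v (tree_root T) => [i ii] [j jj] /=; lia.
rewrite big_pred0 ?addr0; last by move=> v; rewrite (uniqV v) eqxx.
have L e : e \in edges_at root -> b e = d.
  move=> /(edges_atP treeT)[[f ->]|[w]]; first by rewrite bE.1 ffunE.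
  by rewrite (uniqV w) eqxx.
rewrite /root_area.
have [x [y [z [-> p _ _]]]] := root_label treeT degree3 d_gt0 bE.
have E t : t \in [:: x; y; z] -> t = d.
  by rewrite (perm_mem p) => /mem_labelsP[e /L ? ->].
have -> : x = d by apply: E; rewrite !inE eqxx.
have -> : y = d by apply: E; rewrite !inE eqxx orbT.
have -> : z = d by apply: E; rewrite !inE eqxx !orbT.
(* As [d < b0 [:: d; d]], the minimum at the root keeps the side [d]. *)
have [db _ _] := b0P d_gt0 d_gt0.
by rewrite /= min_l// ltW.
Qed.

(** The single tree edge is labelled [b0 [:: d; d]] and lies at both vertices, so both triangles are
    semicyclic with shorter sides [d]; at the root the two terms of the minimum coincide. *)
Lemma BT4 : nvertices T = 2%N -> BT T [ffun=> d] = 2 * Am d.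
Proof.
move=> N2; have [b bE ->] := BTE.
have [w wr wroot] := root_child (eq_leq (esym N2)).
have onlyw v : v != root -> v = w.
  move=> vr; apply/eqP/negPn/negP => vw.
  have : (#|[set v; w; root]%SET| <= 2)%N by rewrite -N2 -[X in (_ <= X)%N]card_ord max_card.
  by rewrite -finset.setUA cardsU1 cards2 !inE negb_or vw vr wr.
have L v e : e \in edges_at v -> e != parent_edge w -> b e = d.
  move=> /(edges_atP treeT)[[f ->]|[u ur]]; first by rewrite bE.1 ffunE.
  by rewrite (onlyw u ur) => -[-> _]; rewrite eqxx.
have dd : d <= d by [].
have [_ _ perm] := D0_semicyclic d_gt0 dd dd.
have AmE : Am d = D0 [:: b0 [:: d; d]; d; d].
  by rewrite /Am perm//; apply/permPl/(perm_catC [:: _; _] [:: _]).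
have others v : w = v \/ root = v -> labels b (edges_at v :\ parent_edge w)%SET = [:: d; d].
  move=> wv.
  have eA : parent_edge w \in edges_at v.
    by case: wv => <-; rewrite ?parent_edge_at// -wroot parent_edge_at_parent.
  have : size (labels b (edges_at v :\ parent_edge w)%SET) = 2%N.
    rewrite size_labels; have := cardsD1 (parent_edge w) (edges_at v).
    by rewrite degree3 eA add1n => -[].
  have E t : t \in labels b (edges_at v :\ parent_edge w)%SET -> t = d.
    by move=> /mem_labelsP[e]; rewrite 2!inE => /andP[ew eA'] ->; exact: L eA' ew.
  move: E; case: (labels _ _) => [|x [|y []]]// E _.
  have -> : x = d by apply: E; rewrite !inE eqxx.
  by have -> : y = d by apply: E; rewrite !inE eqxx orbT.
have bw : b (parent_edge w) = b0 [:: d; d].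
  rewrite -(others w (or_introl erefl)); apply: bE.2 => //.
  exact/(initial_edgeP treeT).
have labE v : w = v \/ root = v -> perm_eq (labels b (edges_at v)) [:: b0 [:: d; d]; d; d].
  move=> wv; rewrite -bw -(others v wv); apply: labels_rem.
  by case: wv => <-; rewrite ?parent_edge_at// -wroot parent_edge_at_parent.
have -> : \sum_(v | v != root) D0 (labels b (edges_at v)) = Am d.
  rewrite (big_pred1 w); last first.
    by move=> v /=; apply/idP/eqP => [/onlyw|->].
  by rewrite perm ?AmE//; apply: labE; left.
have -> : root_area b = Am d; last by ring.
rewrite /root_area AmE.
have [x [y [z [-> p /andP[zy yx] dz]]]] := root_label treeT degree3 d_gt0 bE.
have [db _ _] := b0P d_gt0 d_gt0.
have {}p := perm_trans p (labE root (or_intror erefl)).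
have xE : x = b0 [:: d; d].
  have : x \in [:: b0 [:: d; d]; d; d] by rewrite -(perm_mem p) !inE eqxx.
  rewrite !inE orbb => /orP[/eqP//|/eqP xd].
  have : b0 [:: d; d] \in [:: x; y; z] by rewrite (perm_mem p) !inE eqxx.
  by rewrite !inE => /or3P[] /eqP; lra.
move: p; rewrite xE perm_cons => p.
have eqd t : t \in [:: y; z] -> t = d by rewrite (perm_mem p) !inE orbb => /eqP.
have yE : y = d by apply: eqd; rewrite !inE eqxx.
have zE : z = d by apply: eqd; rewrite !inE eqxx orbT.
by rewrite /= yE zE min_l.
Qed.
End Tree.

(** * The minimum over all trees *)

Lemma BT_valuesP n (x : R) : BT_values [ffun _ : 'I_n => d] x <->
  exists2 T : frontier_graph n, trivalent_tree T & x = BT T [ffun=> d].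
Proof.
have E (s : 'S_n) : [ffun i => [ffun _ : 'I_n => d] (s i)] = [ffun=> d].
  by apply/ffunP => i; rewrite !ffunE.
split=> [[T [s [tT ->]]]|[T tT ->]]; exists T => //; first by rewrite E.
by exists 1%g; rewrite E.
Qed.

(** Trivalent trees with [n] frontier edges all have [n - 2] vertices, so their data range over the
    finite type [X]. The caterpillar shows that there is at least one, and hence the minimum
    exists. *)
Lemma beta_minimum n : (3 <= n)%N -> is_minimum (BT_values [ffun _ : 'I_n => d]) (beta n d).
Proof.
case: n => [|[|[|m]]]// _.
apply: xgetPex.
pose X := ({set {set 'I_m.+1}} * 'I_m.+1 * {ffun 'I_m.+3 -> 'I_m.+1})%type.
pose mk (x : X) : frontier_graph m.+3 := FrontierGraph x.1.1 x.1.2 x.2.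
pose x0 : X := (tree_edges (caterpillar m), tree_root (caterpillar m), foot (caterpillar m)).
have x0P : `[< trivalent_tree (mk x0) >].
  by apply/asboolP; exact: trivalent_caterpillar.
have [x xP xmin] := @Order.TotalTheory.arg_minP _ _ _ x0
  (fun x => `[< trivalent_tree (mk x) >]) (fun x => BT (mk x) [ffun=> d]) x0P.
exists (BT (mk x) [ffun=> d]); split.
  by apply/BT_valuesP; exists (mk x) => //; exact/asboolP.
move=> y /BT_valuesP[T tT ->].
have NT := nvertices_trivalent tT.1 tT.2.
case: T tT NT => N E r f tT /= NT; have {}NT : N = m.+1 by lia.
subst N.
by apply: (xmin (E, r, f)); apply/asboolP.
Qed.
End Bounds.

Theorem proposition3p8 (R : realType) (d : R) (d_gt0 : 0 < d) :
  [/\ forall n : nat, (3 <= n)%N ->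
        is_minimum (BT_values [ffun _ : 'I_n => d]) (beta n d),
      forall n : nat, (4 < n)%N -> (n - 2)%:R * Am d < beta n d,
      beta 4 d = 2 * Am d &
      beta 3 d = D0 [:: d; d; d]].
Proof.
have attained n : (3 <= n)%N -> exists2 T : frontier_graph n, trivalent_tree T &
    nvertices T = (n - 2)%N /\ beta n d = BT T [ffun=> d].
  move=> n3; have [/BT_valuesP[T tT ->] _] := beta_minimum d_gt0 n3.
  by exists T => //; split=> //; exact: nvertices_trivalent tT.1 tT.2.
split.
- exact: beta_minimum.
- move=> n n4; have [|T tT [NT ->]] := attained n; first by lia.
  by rewrite -NT; apply: (BT_ge d_gt0 tT _).2; rewrite NT; lia.
- by have [//|T tT [NT ->]] := attained 4%N; exact: BT4.
- by have [//|T tT [NT ->]] := attained 3%N; exact: BT3.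
Qed.
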